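(* There are continuum many $\mu\in\mathcal U$ which give distinct first-order theories of Steiner systems. That is, there is $\mathcal V\subseteq\mathcal U$ with $|\mathcal V|=2^{\aleph_0}$ such that for all $\mu\ne\nu$ in $\mathcal V$, $\mathrm{Th}(\mathcal G_\mu)\neq\mathrm{Th}(\mathcal G_\nu)$, each $\mathcal G_\mu$ being a Steiner system.
   Context: Linear spaces and $\delta$. $\tau$ has one ternary relation symbol $R$; $\mathbf K^*$ is the class of $\tau$-structures in which $R$ holds only of triples of distinct elements, is symmetric, and satisfies $R(x,y,z)\wedge R(x,y,w)\wedge z\ne w\to R(x,w,z)$. A line of $A\in\mathbf K^*$ is either a pair $\{a,b\}$ of distinct points with $R(a,b,c)$ for no $c\in A$, or a maximal $R$-clique with at least 3 elements; $L(A)$ is the set of lines. A member of $\mathbf K^*$ is a Steiner system if all its lines have the same finite size. For finite $A\in\mathbf K^*$, $\delta(A)=|A|-\sum_{\ell\in L(A)}(|\ell|-2)$. $\mathbf K_0$ is the class of finite $A\in\mathbf K^*$ with $\delta(A')\ge 0$ for all substructures $A'\subseteq A$ (the empty structure is allowed). $\hat{\mathbf K}_0$ is the class of structures all of whose finite substructures are in $\mathbf K_0$. $\delta(A/B)=\delta(A\cup B)-\delta(B)$. For finite $A\subseteq B$, $A\le B$ means $\delta(X)\ge\delta(A)$ for all $A\subseteq X\subseteq B$; for a finite $A\subseteq M\in\hat{\mathbf K}_0$, $A\le M$ means $\delta(X)\ge\delta(A)$ for all finite $X$ with $A\subseteq X\subseteq M$. Good pairs. For disjoint $B,A$ with $A\neq\emptyset$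 and $BA=B\cup A\in\mathbf K_0$ ($B$ may be empty), $A/B$ is $0$-primitive if $B\le BA$, $\delta(A/B)=0$, and there is no $X$ with $B\subsetneq X\subsetneq BA$ and $B\le X\le BA$. $(B,A)$ is a good pair if $A/B$ is $0$-primitive and there is no $B'\subsetneq B$ with $A/B'$ $0$-primitive. $\boldsymbol\alpha$ denotes the isomorphism type of the good pair $(\{b_1,b_2\},\{a\})$ with $R(b_1,b_2,a)$. $\mathcal U$ is the collection of functions $\mu$ assigning to each isomorphism type of good pair $(B,C)$ an integer $\mu(B,C)$ such that $\mu(B,C)\ge\delta(B)$ if $|C|\ge2$, and $\mu(\boldsymbol\alpha)\ge1$. For $B\subseteq M\in\hat{\mathbf K}_0$, $\chi_M(B,C)$ is the (maximal) number of pairwise disjoint copies of $C$ over $B$ in $M$. $\mathbf K_\mu$ is the class of $M\in\mathbf K_0$ with $\chi_M(B,C)\le\mu(B,C)$ for every good pair $(B,C)$ with $B\subseteq M$; $\hat{\mathbf K}_\mu$ is the class of structures all of whose finite substructures are in $\mathbf K_\mu$. $\mathcal G_\mu$ is the $(\mathbf K_\mu,\le)$-generic: the countable $M\in\hat{\mathbf K}_\mu$ such that whenever $A\le M$ is finite and $A\le B\in\mathbf K_\mu$ there is $B'\le M$ isomorphic to $B$ over $A$. $\mathrm{Th}$ denotes the complete first-order theory. *)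

(* Defs.v *)
From HB Require Import structures.
From mathcomp Require Import all_boot all_order all_algebra finmap.
From mathcomp Require Import boolp classical_sets functions cardinality.

Set Implicit Arguments.
Unset Strict Implicit.
Unset Printing Implicit Defensive.

Import Order.TTheory GRing.Theory Num.Theory.

Local Open Scope fset_scope.
Local Open Scope ring_scope.

(* Finite structures are handled either as finite subsets [A : {fset M}] of an
   ambient structure [M] (with the induced relation), or, when an abstract
   finite structure is needed, as a structure with domain ['I_n]. *)
Record structure := Structure {
  dom :> choiceType;
  rel3 : dom -> dom -> dom -> Prop }.

Definition substructure (M : structure) (A : {fset M}) : structure :=
  Structure (fun x y z : A => rel3 (val x) (val y) (val z)).

Definition finstr n (r : 'I_n -> 'I_n -> 'I_n -> Prop) : structure :=
  Structure r.

Definition embedding (M N : structure) (f : M -> N) : Prop :=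
  injective f /\ forall x y z, rel3 x y z <-> rel3 (f x) (f y) (f z).

Definition Kstar (M : structure) : Prop :=
  [/\ forall x y z : M, rel3 x y z -> [/\ x <> y, x <> z & y <> z],
      forall x y z : M, rel3 x y z -> rel3 y x z /\ rel3 x z y
    & forall x y z w : M, rel3 x y z -> rel3 x y w -> z <> w -> rel3 x w z].

(* Lines of the substructure of [M] with domain [A]. *)
Section Lines.
Variables (M : structure) (A : set M).

Definition clique (l : set M) : Prop :=
  (l `<=` A)%classic /\
  forall x y z, l x -> l y -> l z -> x <> y -> x <> z -> y <> z -> rel3 x y z.

Definition trivial_line (l : set M) : Prop :=
  exists a b, [/\ A a, A b, a <> b, forall c, A c -> ~ rel3 a b c
    & l = [set a; b]%classic].

Definition nontrivial_line (l : set M) : Prop :=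
  [/\ clique l,
      exists x y z, [/\ l x, l y & l z] /\ [/\ x <> y, x <> z & y <> z]
    & forall l', clique l' -> (l `<=` l')%classic -> l' = l].

Definition line (l : set M) : Prop := trivial_line l \/ nontrivial_line l.

End Lines.

Definition steiner_system (M : structure) : Prop :=
  Kstar M /\
  exists k : nat, forall l : set M, line setT l -> (l #= `I_k)%card.

Section Finite.
Variable M : structure.
Implicit Types A B C X : {fset M}.

Definition lines A : {fset {fset M}} :=
  [fset l in fpowerset A | `[< line [set` A]%classic [set` l]%classic >]].

Definition delta A : int :=
  (#|` A|)%:Z - \sum_(l <- lines A) ((#|` l|)%:Z - 2).

(* [delta_rel A B] is delta(A/B). *)
Definition delta_rel A B : int := delta (A `|` B) - delta B.

Definition K0 A : Prop :=
  Kstar (substructure A) /\ forall A', A' `<=` A -> 0 <= delta A'.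

Definition strong A B : Prop :=
  A `<=` B /\ forall X, A `<=` X -> X `<=` B -> delta A <= delta X.

Definition strong_in A : Prop := forall X, A `<=` X -> delta A <= delta X.

(* [zero_primitive B A]: A/B is 0-primitive. *)
Definition zero_primitive B A : Prop :=
  [/\ [disjoint B & A], A <> fset0 & K0 (B `|` A)] /\
  [/\ strong B (B `|` A), delta_rel A B = 0
    & ~ exists X, [/\ B `<` X, X `<` B `|` A, strong B X
                    & strong X (B `|` A)]].

Definition is_good_pair B A : Prop :=
  zero_primitive B A /\ ~ exists B', B' `<` B /\ zero_primitive B' A.

End Finite.

(* Every good pair is isomorphic to one whose union is some ['I_n]; functions
   on isomorphism types of good pairs are represented by the
   isomorphism-invariant functions on [good_pair]. *)
Record good_pair := GoodPair {
  gp_size : nat;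
  gp_rel : 'I_gp_size -> 'I_gp_size -> 'I_gp_size -> Prop;
  gp_base : {fset finstr gp_rel};
  gp_ext : {fset finstr gp_rel} := [fset x | x : 'I_gp_size] `\` gp_base;
  gp_good : is_good_pair gp_base gp_ext }.

Definition gp_str (p : good_pair) : structure := finstr (@gp_rel p).

Definition gp_iso (p q : good_pair) : Prop :=
  exists f : gp_str p -> gp_str q,
    [/\ bijective f, embedding f
      & forall x, (f x \in gp_base q) = (x \in gp_base p)].

Definition is_alpha (p : good_pair) : Prop :=
  exists b1 b2 a : gp_str p,
    [/\ b1 <> b2, gp_base p = [fset b1; b2], gp_ext p = [fset a]
      & rel3 b1 b2 a].

Definition calU : set (good_pair -> int) :=
  [set mu | [/\ forall p q, gp_iso p q -> mu p = mu q,
                forall p, (2 <= #|` gp_ext p|)%N -> delta (gp_base p) <= mu p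
              & forall p, is_alpha p -> 1 <= mu p]]%classic.

(* [C] is a copy, inside [A], of the extension of [p] over its base, the base
   being placed in [M] by [f]. *)
Definition is_copy (M : structure) (A : {fset M}) (p : good_pair)
    (f : substructure (gp_base p) -> M) (C : {fset M}) : Prop :=
  C `<=` A /\
  exists g : gp_str p -> M,
    [/\ embedding g, forall b, g (val b) = f b
      & C = [fset g x | x in gp_ext p]].

Definition disjoint_copies (M : structure) (A : {fset M}) (p : good_pair)
    (f : substructure (gp_base p) -> M) (F : {fset {fset M}}) : Prop :=
  (forall C, C \in F -> is_copy A f C) /\
  (forall C C', C \in F -> C' \in F -> C <> C' -> [disjoint C & C']).

Definition chi (M : structure) (A : {fset M}) (p : good_pair)
    (f : substructure (gp_base p) -> M) : nat :=
  \max_(F <- fpowerset (fpowerset A) | `[< disjoint_copies A f F >]) #|` F|.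

Definition K_mu (mu : good_pair -> int) (M : structure) (A : {fset M}) : Prop :=
  K0 A /\
  forall (p : good_pair) (f : substructure (gp_base p) -> M),
    embedding f -> (forall b, f b \in A) -> (chi A f)%:Z <= mu p.

Definition K_mu_hat (mu : good_pair -> int) (M : structure) : Prop :=
  forall A : {fset M}, K_mu mu A.

(* In the extension property the finite structure extending the strong subset
   of [M] has domain ['I_n], and the strong subset itself is the image of
   [A : {fset 'I_n}] under [f]; [f] is defined on [A] only, so that the case
   of an empty [A] is not lost when [M] is empty. *)
Definition generic (mu : good_pair -> int) (M : structure) : Prop :=
  [/\ countable [set: M]%classic, K_mu_hat mu M
    & forall n (r : 'I_n -> 'I_n -> 'I_n -> Prop) (A : {fset finstr r})
        (f : substructure A -> M),
        let B : {fset finstr r} := [fset x | x : 'I_n] in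
        K_mu mu B -> strong A B ->
        embedding f -> strong_in [fset f x | x : A] ->
        exists g : finstr r -> M,
          [/\ embedding g, forall a, g (val a) = f a
            & strong_in [fset g x | x : 'I_n]]].

(* [formula n]: first-order formulas with free variables indexed by ['I_n];
   the quantifier binds variable 0. Sentences are the elements of [formula 0],
   so satisfaction makes sense in the empty structure as well. *)
Inductive formula (n : nat) : Type :=
| FEq of 'I_n & 'I_n
| FRel of 'I_n & 'I_n & 'I_n
| FNot of formula n
| FAnd of formula n & formula n
| FAll of formula n.+1.

Fixpoint sat (M : structure) n (phi : formula n) : n.-tuple M -> Prop :=
  match phi with
  | FEq i j => fun v => tnth v i = tnth v j
  | FRel i j k => fun v => rel3 (tnth v i) (tnth v j) (tnth v k)
  | FNot p => fun v => ~ sat p v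
  | FAnd p q => fun v => sat p v /\ sat q v
  | FAll p => fun v => forall x : M, sat p [tuple of x :: v]
  end.

Definition Th (M : structure) : set (formula 0) :=
  [set phi | sat phi ([tuple] : 0.-tuple M)]%classic.

(* Main.v *)
Require Import Defs.
From mathcomp Require Import all_boot all_order all_algebra finmap.
From mathcomp Require Import boolp classical_sets functions cardinality.
From mathcomp Require Import zify.

(** Choose mu(alpha) = 1, so that every member of K_mu is a partial Steiner
    triple system and delta counts points minus triples; for nonempty B and
    |C| >= 2 put mu(B,C) = 3|B| + 9, and let mu(empty,C) be 0 or 1 according to
    an arbitrary s : nat -> bool evaluated at |C| - 7.  For k >= 0 the cyclic
    configuration on Z/(k+7) with triples {i, i+1, i+3} is 0-primitive over the
    empty set, and it embeds in the generic structure exactly when s(k) is true,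
    which a single first-order sentence expresses; distinct s hence give
    distinct theories.

    Amalgamation: glue freely a primitive extension A u N of A to a structure C
    in which A is strong.  Suppose that a good pair has too many disjoint copies
    over a base E.  If E lies on one side of the amalgam, then a copy either is
    N itself, which yields an embedding of A u N over A into C, or all copies
    lie on that side.  If E straddles the amalgam, the copies number at most
    3|E|, which the generous values of mu allow.  The generic structure is the
    limit of a chain of relations on nat treating every primitive extension
    problem at arbitrarily late stages. *)

Set Implicit Arguments.
Unset Strict Implicit.
Unset Printing Implicit Defensive.

Import Order.TTheory GRing.Theory Num.Theory.

Local Open Scope fset_scope.
Local Open Scope ring_scope.

(** * Partial triple systems and the predimension *)

(** The base of a good pair may be spread over both sides of an amalgam, where neither side controls
    the copies, so mu must dominate a count depending on |B| alone. A copy over such a base either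
    accounts for one unit of predimension or uses a block through the base and N; there are at most
    |B| of these resources together, and a block meets at most three disjoint copies, whence 3|B|.
    An empty base never straddles: only there may mu drop to 0, and this is where s is encoded. The
    summand 9 makes room for the cyclic configurations themselves, in which a point lies on three
    blocks, each meeting at most three disjoint copies. Free gluing also fails when two points of A
    would receive two different third points. Primitivity then shrinks N to a single point, and the
    third point already present in C serves as its image. The generic structure is a Steiner triple
    system because a missing third point can be adjoined to a strong finite set without leaving
    K_mu: a point on a single block belongs to no copy having at least two points. *)

Section Predimension.
Variable M : structure.
Implicit Types A B E F S T X Y : {fset M}.

(** The last clause replaces the transitivity of [Kstar]: it makes every nontrivial line a triple,
    which is the effect of giving [alpha] the value 1. *)
Definition psts : Prop :=
  [/\ forall x y z : M, rel3 x y z -> [/\ x <> y, x <> z & y <> z],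
      forall x y z : M, rel3 x y z -> rel3 y x z /\ rel3 x z y
    & forall x y z w : M, rel3 x y z -> rel3 x y w -> z = w].

Definition triple T : Prop := exists x y z, rel3 x y z /\ T = [fset x; y; z].

Definition blocks X : {fset {fset M}} :=
  [fset T in fpowerset X | `[< triple T >]].

Definition predim X : int := (#|` X|)%:Z - (#|` blocks X|)%:Z.

Lemma blocksP X T : reflect (T `<=` X /\ triple T) (T \in blocks X).
Proof.
rewrite !inE /= fpowersetE; apply: (iffP andP) => -[h1 h2]; split=> //.
  by apply/asboolP.
by apply/asboolP.
Qed.

Lemma mem_blocks X x y z :
  rel3 x y z -> x \in X -> y \in X -> z \in X -> [fset x; y; z] \in blocks X.
Proof.
move=> r hx hy hz; apply/blocksP; split; last by exists x, y, z.
by apply/fsubsetP=> t; rewrite !inE -orbA => /or3P[] /eqP->.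
Qed.

Lemma blocks_sub X Y : X `<=` Y -> blocks X `<=` blocks Y.
Proof.
move=> XY; apply/fsubsetP=> T /blocksP[TX hT]; apply/blocksP; split=> //.
exact: fsubset_trans XY.
Qed.

Lemma blocksI X Y : blocks (X `&` Y) = blocks X `&` blocks Y.
Proof.
apply/fsetP=> T; rewrite in_fsetI; apply/blocksP/andP.
  by rewrite fsubsetI => -[/andP[? ?] ?]; split; apply/blocksP.
by case=> /blocksP[h1 h] /blocksP[h2 _]; split=> //; rewrite fsubsetI h1.
Qed.

Lemma predim_submod A B :
  predim (A `|` B) + predim (A `&` B) <= predim A + predim B.
Proof.
rewrite /predim blocksI.
have h1 := cardfsUI A B; have h2 := cardfsUI (blocks A) (blocks B).
have : (#|` blocks A `|` blocks B| <= #|` blocks (A `|` B)|)%N.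
  apply: fsubset_leq_card; rewrite fsubUset !blocks_sub ?fsubsetUl//.
  exact: fsubsetUr.
lia.
Qed.

Lemma predim_free A B :
  (forall T, T \in blocks (A `|` B) -> T `<=` A \/ T `<=` B) ->
  predim (A `|` B) + predim (A `&` B) = predim A + predim B.
Proof.
move=> h; rewrite /predim blocksI.
have h1 := cardfsUI A B; have h2 := cardfsUI (blocks A) (blocks B).
have -> : blocks (A `|` B) = blocks A `|` blocks B.
  apply/eqP; rewrite eqEfsubset fsubUset (blocks_sub (fsubsetUl A B))
    (blocks_sub (fsubsetUr A B)) !andbT.
  apply/fsubsetP=> T hT; case/blocksP: (hT) => _ tT.
  by rewrite in_fsetU; case: (h T hT) => hT'; apply/orP; [left|right];
    apply/blocksP.
lia.
Qed.

Lemma predim0 : predim fset0 = 0.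
Proof.
rewrite /predim cardfs0 (_ : blocks _ = fset0) ?cardfs0 //.
apply/fsetP=> T; rewrite in_fset0; apply/blocksP => -[].
rewrite fsubset0 => /eqP -> [x [y [z [_ /fsetP /(_ x)]]]].
by rewrite !inE eqxx.
Qed.

Hypothesis pM : psts.

Lemma triple_rel T x y z : triple T -> x \in T -> y \in T -> z \in T ->
  x <> y -> x <> z -> y <> z -> rel3 x y z.
Proof.
case: pM => _ hs _ [a [b [c [r ->]]]].
have [r1 r2] := hs _ _ _ r; have [_ r3] := hs _ _ _ r1.
have [r4 _] := hs _ _ _ r2; have [r5 _] := hs _ _ _ r3.
by rewrite !inE -!orbA => /or3P[] /eqP-> /or3P[] /eqP-> /or3P[] /eqP->.
Qed.

Lemma triple_card T : triple T -> #|` T| = 3%N.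
Proof.
case: pM => hd _ _ [x [y [z [r ->]]]].
have [/eqP xy /eqP xz /eqP yz] := hd _ _ _ r.
rewrite fsetUC cardfsU1 !inE negb_or cardfs2.
by rewrite xy !(eq_sym z) xz yz.
Qed.

Lemma line_trivial_or_block X T : T \in lines X -> #|` T| = 2%N \/ T \in blocks X.
Proof.
case: (pM) => _ _ hu.
move=> hT; have : (T `<=` X) && `[< line [set` X]%classic [set` T]%classic >].
  by move: hT; rewrite !inE /= fpowersetE.
move=> {hT} /andP[TX /asboolP[]].
  move=> [a [b [_ _ ab _ h]]]; left.
  have -> : T = [fset a; b].
    apply/fsetP=> t; have := congr1 (fun s => s t) h.
    rewrite /= => e; apply/idP/idP => [hT|]; rewrite !inE.
      have : [set` T]%classic t by [].
      by rewrite h => -[->|->]; rewrite eqxx ?orbT.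
    move=> /orP[] /eqP->.
      have : [set a; b]%classic a by left.
      by rewrite -h.
    have : [set a; b]%classic b by right.
    by rewrite -h.
  by rewrite cardfs2; move/eqP: ab => ->.
move=> [[_ cl] [x [y [z [[hx hy hz] [xy xz yz]]]]] _]; right.
have r := cl _ _ _ hx hy hz xy xz yz.
suff -> : T = [fset x; y; z].
  apply: mem_blocks => //; exact: (fsubsetP TX).
apply/fsetP=> t; rewrite !inE; apply/idP/idP => [ht|]; last first.
  by rewrite -orbA => /or3P[] /eqP->.
have [//|/eqP tx] := eqVneq t x; have [//|/eqP ty] := eqVneq t y.
apply/eqP; apply: (hu x y) => //.
by apply: cl => // e; [apply: tx | apply: ty].
Qed.

Lemma block_line X T : T \in blocks X -> T \in lines X.
Proof.
case: (pM) => hd _ hu.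
move=> /blocksP[TX tT]; rewrite !inE /= fpowersetE TX /=; apply/asboolP; right.
have [x [y [z [r eT]]]] := tT.
have [xy xz yz] := hd _ _ _ r.
have [hx hy hz] : [/\ x \in T, y \in T & z \in T].
  by rewrite eT !inE !eqxx !orbT.
split.
- split; first by move=> t /= /(fsubsetP TX).
  by move=> a b c /= *; apply: (triple_rel tT).
- by exists x, y, z.
move=> l' [_ cl] sub; apply/seteqP; split=> // t ht /=.
rewrite eT !inE.
have [//|/eqP tx] := eqVneq t x; have [//|/eqP ty] := eqVneq t y.
apply/eqP; apply: (hu x y) => //.
by apply: cl => //; [exact: sub | exact: sub | move=> e; apply: tx | move=> e; apply: ty].
Qed.

(** Lines with two points contribute 0 to the sum and triples contribute 1, so the sum counts
    blocks. *)
Lemma deltaE X : delta X = predim X.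
Proof.
rewrite /delta /predim; congr (_ - _).
rewrite (bigID (fun T => T \in blocks X)) /= [X in _ + X]big1_seq ?addr0; last first.
  by move=> T /andP[nT /line_trivial_or_block[->|]]//; rewrite (negPf nT).
rewrite -big_filter.
rewrite (perm_big (enum_fset (blocks X))); last first.
  apply: uniq_perm; rewrite ?filter_uniq ?fset_uniq //.
  move=> T; rewrite mem_filter; apply/andP/idP => [[]//|hT]; split=> //.
  exact: block_line.
rewrite (eq_big_seq (fun _ => 1)); last first.
  by move=> T /blocksP[_ /triple_card ->].
by rewrite big_const_seq count_predT iter_addr_0 natz.
Qed.

End Predimension.
Arguments psts : clear implicits.

(** * Partial embeddings and good pairs *)

(** A total function that is controlled only on [A] avoids maps out of the subtype of [A] when
    domains are enlarged or glued. *)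
Definition pemb (M N : structure) (A : {fset M}) (h : M -> N) : Prop :=
  {in A &, injective h} /\
  {in A & &, forall x y z, rel3 x y z <-> rel3 (h x) (h y) (h z)}.

Section PartialEmbeddings.
Variables M N : structure.
Implicit Types (A X : {fset M}) (h : M -> N).

Lemma pemb_sub A X h : X `<=` A -> pemb A h -> pemb X h.
Proof.
move=> /fsubsetP s [hi hr]; split=> [x y /s ? /s ?|x y z /s ? /s ? /s ?].
  exact: hi.
exact: hr.
Qed.

Lemma embedding_pemb A h : embedding h -> pemb A h.
Proof. by case=> hi hr; split=> [x y _ _ /hi|x y z _ _ _]. Qed.

Lemma pemb_imfset_inj A X Y h : {in A &, injective h} -> X `<=` A -> Y `<=` A ->
  h @` X = h @` Y -> X = Y.
Proof.
move=> hi.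
have main X' Y' : X' `<=` A -> Y' `<=` A -> h @` X' = h @` Y' -> X' `<=` Y'.
  move=> /fsubsetP s1 /fsubsetP s2 e; apply/fsubsetP=> x hx.
  have : h x \in h @` Y' by rewrite -e in_imfset.
  by move=> /imfsetP[y /= hy e']; rewrite (hi x y (s1 _ hx) (s2 _ hy) e').
by move=> s1 s2 e; apply/eqP; rewrite eqEfsubset; apply/andP; split; apply: main.
Qed.

Lemma blocks_pemb A h : pemb A h ->
  blocks (h @` A) = [fset h @` (T : {fset M}) | T in blocks A].
Proof.
move=> [hi hr]; apply/fsetP=> T'; apply/blocksP/imfsetP => /=.
  move=> [s [x' [y' [z' [r e]]]]].
  have [/imfsetP[x /= hx ex] /imfsetP[y /= hy ey] /imfsetP[z /= hz ez]] :
    [/\ x' \in h @` A, y' \in h @` A & z' \in h @` A].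
    by split; apply: (fsubsetP s); rewrite e !inE eqxx ?orbT.
  exists [fset x; y; z]; last by rewrite !imfsetU !imfset_fset1 e ex ey ez.
  by apply: mem_blocks => //; apply/hr => //; rewrite -ex -ey -ez.
move=> [T /blocksP[s [x [y [z [r e]]]]] ->]; split.
  by apply/fsubsetP=> _ /imfsetP[u /= uT ->]; rewrite in_imfset //=; exact: (fsubsetP s).
have [hx hy hz] : [/\ x \in A, y \in A & z \in A].
  by split; apply: (fsubsetP s); rewrite e !inE eqxx ?orbT.
exists (h x), (h y), (h z); split; first exact/hr.
by rewrite e !imfsetU !imfset_fset1.
Qed.

Lemma predim_pemb A h : pemb A h -> predim (h @` A) = predim A.
Proof.
move=> hp; have [hi _] := hp; rewrite /predim blocks_pemb // !card_in_imfset //=.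
move=> X Y /blocksP[s1 _] /blocksP[s2 _]; exact: (pemb_imfset_inj hi s1 s2).
Qed.

Lemma psts_embedding h : embedding h -> psts N -> psts M.
Proof.
move=> [hi hr] [hd hs hu]; split=> [x y z /hr /hd[h1 h2 h3]|x y z /hr /hs[]|].
- by split=> e; [apply: h1 | apply: h2 | apply: h3]; rewrite e.
- by move=> /hr ? /hr.
by move=> x y z w /hr r1 /hr r2; apply: hi; apply: hu r1 r2.
Qed.

End PartialEmbeddings.

Section Good.
Variable M : structure.
Implicit Types A B E F S T X Y : {fset M}.

(** Strict growth at every proper nonempty part of [F], with equality at [F], packs together
    strength of [E], relative predimension zero and absence of intermediate strong sets. *)
Definition minimal_ext E F : Prop :=
  predim (E `|` F) = predim E /\
  forall Y, Y `<=` F -> Y <> fset0 -> Y <> F -> predim E < predim (E `|` Y).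

(** The last clause is the form in which minimality of the base enters all counting arguments: every
    base point is joined to every copy by a block. *)
Definition good E F : Prop :=
  [/\ [disjoint E & F], F <> fset0, minimal_ext E F
    & forall e, e \in E ->
      exists2 T, T \in blocks (E `|` F) & e \in T /\ exists2 y, y \in F & y \in T].

Lemma fset_between E F X : E `<=` X -> X `<=` E `|` F -> X = E `|` (X `&` F).
Proof.
move=> /fsubsetP h1 /fsubsetP h2; apply/fsetP=> t; rewrite !inE.
move: (h1 t) (h2 t); rewrite !inE; case: (t \in E) => [->//|_ h].
by apply/idP/andP => [hx|[]//]; split=> //; apply: h.
Qed.

Hypothesis pM : psts M.

Lemma psts_substructure A : psts (substructure A).
Proof.
apply: (@psts_embedding (substructure A) M val) => //.
Qed.

Lemma psts_Kstar : Kstar M.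
Proof.
case: pM => hd hs hu; split=> // x y z w r1 r2 zw.
by case: zw; apply: hu r1 r2.
Qed.

Lemma zero_primitiveP E F : zero_primitive E F <->
  [/\ [disjoint E & F], F <> fset0, forall X, X `<=` E `|` F -> 0 <= predim X
    & minimal_ext E F].
Proof.
split.
  move=> [[dj F0 [_ hK]] [[_ hs] hd hn]]; split=> //.
    by move=> X /hK; rewrite deltaE.
  have e : predim (E `|` F) = predim E.
    by move: hd; rewrite /delta_rel !deltaE // fsetUC; lia.
  split=> // Y YF Y0 Y1.
  have hle X : E `<=` X -> X `<=` E `|` F -> predim E <= predim X.
    by move=> h1 h2; rewrite -!deltaE //; exact: hs.
  have s1 : E `<=` E `|` Y by exact: fsubsetUl.
  have s2 : E `|` Y `<=` E `|` F by exact: fsetUS.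
  rewrite lt_neqAle hle // andbT; apply/eqP => e'.
  (* With equality, this set would have the least predimension possible above [E], hence be strong
     in the whole and a forbidden intermediate set. *)
  apply: hn; exists (E `|` Y); split.
  - rewrite fproperEneq s1 andbT; apply/eqP => eE; apply: Y0.
    apply/fsetP=> t; rewrite inE; apply/negP=> tY.
    have : t \in E by rewrite eE inE tY orbT.
    by move/(fdisjointP dj); rewrite (fsubsetP YF).
  - rewrite fproperEneq s2 andbT; apply/eqP => eE; apply: Y1.
    apply/eqP; rewrite eqEfsubset YF; apply/fsubsetP=> t tF.
    have : t \in E `|` Y by rewrite eE inE tF orbT.
    by rewrite inE => /orP[/(fdisjointP dj)|//]; rewrite tF.
  - split=> // X h1 h2; rewrite !deltaE //; apply: hle => //.
    exact: fsubset_trans s2.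
  split=> // X h1 h2; rewrite !deltaE // -e'; apply: hle => //.
  exact: fsubset_trans h1.
move=> [dj F0 h0 [e hlt]].
have hle X : E `<=` X -> X `<=` E `|` F -> predim E <= predim X.
  move=> h1 h2; rewrite (fset_between h1 h2).
  have [->|/eqP Y0] := eqVneq (X `&` F) fset0; first by rewrite fsetU0.
  have [->|/eqP Y1] := eqVneq (X `&` F) F; first by rewrite e.
  by apply/ltW/hlt => //; exact: fsubsetIr.
split; first split=> //.
  split=> [|X hX]; last by rewrite deltaE //; exact: h0.
  by case: (psts_substructure (E `|` F)) => hd hs hu; split=> // x y z w r1 r2 zw;
    case: zw; apply: hu r1 r2.
split.
- by split=> [|X h1 h2]; [exact: fsubsetUl | rewrite !deltaE //; exact: hle].
- by rewrite /delta_rel !deltaE // fsetUC e subrr.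
move=> [X [p1 p2 _ [_ hs]]].
have s1 := fproper_sub p1; have s2 := fproper_sub p2.
have := hs (E `|` F) s2 (fsubset_refl _).
have eX := fset_between s1 s2.
rewrite !deltaE // e leNgt eX hlt ?fsubsetIr// => e1.
  by move: p1; rewrite fproperEneq eX e1 fsetU0 eqxx.
by move: p2; rewrite fproperEneq eX e1 eqxx.
Qed.

(** If no block joins [e] to [F], then [E] and the rest are freely joined over [E] without [e].
    Deleting [e] from the base then changes no relative predimension, and [F] stays 0-primitive over
    the smaller base. *)
Lemma good_of_pair E F : is_good_pair E F -> good E F.
Proof.
move=> [/zero_primitiveP[dj F0 h0 hm] hn]; split=> // e eE.
apply: contrapT => hT; apply: hn; exists (E `\ e); split.
  by rewrite fproperD1.
have key Y : Y `<=` F ->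
    predim (E `|` Y) + predim (E `\ e) = predim E + predim (E `\ e `|` Y).
  move=> YF.
  have e1 : E `|` Y = E `|` (E `\ e `|` Y).
    by apply/fsetP=> t; rewrite !inE; case: (t \in E); rewrite ?andbF.
  have e2 : E `\ e = E `&` (E `\ e `|` Y).
    apply/fsetP=> t; rewrite !inE; case: (boolP (t \in E)) => [tE|]; rewrite ?andbF//=.
    have := fdisjointP dj t tE; case: (boolP (t \in Y)) => [/(fsubsetP YF) ->//|_ _].
    by rewrite orbF andbT.
  have := @predim_free M E (E `\ e `|` Y); rewrite -e1 -e2; apply=> T hTB.
  have [sT tT] := blocksP _ _ hTB.
  have [eT|eT] := boolP (e \in T); [left|right]; apply/fsubsetP=> t tin.
    have := fsubsetP sT t tin; rewrite inE => /orP[//|tY].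
    case: hT; exists T; last by split=> //; exists t => //; apply: (fsubsetP YF).
    by apply: (fsubsetP (blocks_sub _)) hTB; exact: fsetUS.
  have := fsubsetP sT t tin; rewrite !inE.
  by have [te|//] := eqVneq t e; rewrite te (negPf eT) in tin.
apply/zero_primitiveP; split=> //.
- by apply: fdisjointWl dj; exact: fsubD1set.
- move=> X sX; apply: h0; apply: fsubset_trans sX _; apply: fsetSU.
  exact: fsubD1set.
case: hm => e1 e2; split; first by have := key F (fsubset_refl _); rewrite e1; lia.
by move=> Y YF Y0 Y1; have := key Y YF; have := e2 Y YF Y0 Y1; lia.
Qed.

End Good.

Lemma good_embedding (M N : structure) (h : M -> N) E F :
  embedding h -> good E F -> good (h @` E) (h @` F).
Proof.
move=> he [dj F0 [e1 e2] hb].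
have pe A : predim (h @` A) = predim A by apply: predim_pemb; apply: embedding_pemb.
have [hi hr] := he; split.
- apply/fdisjointP=> _ /imfsetP[x /= xE ->]; apply/negP=> /imfsetP[y /= yF /hi exy].
  by have := fdisjointP dj _ xE; rewrite exy yF.
- move=> e; apply: F0; apply/fsetP=> t; rewrite inE; apply/negP=> tF.
  by have : h t \in fset0 by rewrite -e in_imfset.
- split; first by rewrite -imfsetU !pe.
  move=> Y YF Y0 Y1; pose X := [fset x in F | h x \in Y].
  have eY : Y = h @` X.
    apply/fsetP=> t; apply/idP/imfsetP => [tY|[x /=]]; last first.
      by rewrite !inE /= => /andP[_ hx] ->.
    have /imfsetP[x /= xF ex] := fsubsetP YF t tY.
    by exists x => //; rewrite !inE /= xF -ex.
  rewrite eY -imfsetU !pe; apply: e2.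
  - by apply/fsubsetP=> x; rewrite !inE => /andP[].
  - by move=> X0; apply: Y0; rewrite eY X0 imfset0.
  - by move=> X1; apply: Y1; rewrite eY X1.
move=> _ /imfsetP[e /= eE ->]; have [T hT [eT [y yF yT]]] := hb e eE.
exists (h @` T).
  rewrite -imfsetU blocks_pemb; last exact: embedding_pemb.
  by apply/imfsetP; exists T.
by split; [rewrite in_imfset | exists (h y); rewrite in_imfset].
Qed.

(** * The functions mu and families of copies *)

(** Only cardinalities occur, so invariance under isomorphism is immediate. The shift by 7 matches
    the size k + 7 of the cyclic configurations. *)
Definition mu_bound (s : nat -> bool) (p : good_pair) : nat :=
  if #|` gp_ext p| == 1%N then 1%N
  else if gp_base p == fset0 then s (#|` gp_ext p| - 7)%N : nat
  else (3 * #|` gp_base p| + 9)%N.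

Definition mu_of (s : nat -> bool) (p : good_pair) : int := (mu_bound s p)%:Z.

(** Every line has at least two points. Arbitrary structures are allowed, because [calU] constrains
    mu also at good pairs with lines longer than three. *)
Lemma delta_le_card (M : structure) (A : {fset M}) : delta A <= (#|` A|)%:Z.
Proof.
rewrite /delta lerBlDl lerDr big_seq; apply: sumr_ge0 => l.
rewrite !inE /= => /andP[_ /asboolP hl]; rewrite subr_ge0 lez_nat.
have [x [y [lx ly xy]]] : exists x y, [/\ x \in l, y \in l & x != y].
  case: hl => [[a [b [_ _ /eqP ab _ e]]]|[_ [x [y [z [[lx ly _] [/eqP xy _ _]]]]] _]].
    exists a, b; split=> //.
      by have : [set a; b]%classic a; [left | rewrite -e].
    by have : [set a; b]%classic b; [right | rewrite -e].
  by exists x, y.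
have : [fset x; y] `<=` l by apply/fsubsetP=> t; rewrite !inE => /orP[] /eqP->.
by move/fsubset_leq_card; rewrite cardfs2 xy.
Qed.

Lemma gp_iso_card p q : gp_iso p q ->
  #|` gp_base p| = #|` gp_base q| /\ #|` gp_ext p| = #|` gp_ext q|.
Proof.
move=> [f [[g fg gf] _ hb]].
have eb : gp_base q = f @` gp_base p.
  apply/fsetP=> t; apply/idP/imfsetP => [tq|[x /= xp ->]]; last by rewrite hb.
  by exists (g t); rewrite ?gf //= -hb gf.
have ee : gp_ext q = f @` gp_ext p.
  apply/fsetP=> t; apply/idP/imfsetP => [|[x /=]].
    by rewrite !inE => /andP[tq _]; exists (g t); rewrite ?gf // !inE -hb gf tq.
  by rewrite !inE => /andP[xp _] ->; rewrite hb xp.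
by rewrite eb ee !card_imfset //=; exact: can_inj fg.
Qed.

Lemma mu_of_calU s : calU (mu_of s).
Proof.
split.
- by move=> p q /gp_iso_card[e1 e2]; rewrite /mu_of /mu_bound -!cardfs_eq0 e1 e2.
- move=> p p2; rewrite /mu_of /mu_bound; case: eqP => [e|_]; first by rewrite e in p2.
  case: eqP => [->|_].
    by apply: le_trans (delta_le_card _) _; rewrite cardfs0.
  by apply: le_trans (delta_le_card _) _; rewrite lez_nat; lia.
move=> p [b1 [b2 [a [_ _ ea _]]]].
by rewrite /mu_of /mu_bound ea cardfs1.
Qed.

(** Adding [a] at no cost forces a new block; it contains [a], and its other two points lie in [E].
    Hence one-point extensions look like [alpha]. *)
Lemma good_point (M : structure) (E : {fset M}) (a : M) : psts M ->
  [disjoint E & [fset a]] -> predim (E `|` [fset a]) = predim E ->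
  exists x y, [/\ x \in E, y \in E & rel3 x y a].
Proof.
move=> pM dj e1.
have [T Tin Tout] : exists2 T, T \in blocks (E `|` [fset a]) & T \notin blocks E.
  apply: contrapT => h.
  have : blocks (E `|` [fset a]) `<=` blocks E.
    by apply/fsubsetP=> T hT; apply: contrapT => /negP hT'; apply: h; exists T.
  move/fsubset_leq_card; move: e1; rewrite /predim cardfsU.
  by have /eqP -> : E `&` [fset a] == fset0 by []; rewrite cardfs0 cardfs1; lia.
have [sT tT] := blocksP _ _ Tin.
have inT t : t \in T -> t <> a -> t \in E.
  by move=> /(fsubsetP sT); rewrite !inE => /orP[//|/eqP].
have aT : a \in T.
  apply: contraR Tout => aT; apply/blocksP; split=> //; apply/fsubsetP=> t tT'.
  by apply: inT => // ta; rewrite -ta tT' in aT.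
have := triple_card pM tT; rewrite (cardfsD1 a) aT => e2.
have [x] : exists x, x \in T `\ a by apply/fset0Pn; rewrite -cardfs_gt0; lia.
have [y] : exists y, y \in T `\ a `\ x.
  by apply/fset0Pn; rewrite -cardfs_gt0; move: e2; rewrite (cardfsD1 x); lia.
rewrite !inE => /and3P[/eqP yx /eqP ya yT] /andP[/eqP xa xT].
exists x, y; split; [exact: inT | exact: inT |].
by apply: (triple_rel pM tT) => //; exact: nesym.
Qed.

Section Copies.
Variable M : structure.
Implicit Types A B E F S T X Y C : {fset M}.

Lemma chi_leP A (p : good_pair) (f : substructure (gp_base p) -> M) n :
  (chi A f <= n)%N <->
  forall Fam, disjoint_copies A f Fam -> (#|` Fam| <= n)%N.
Proof.
split=> [/bigmax_leqP_seq h Fam hF|h].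
  apply: h; last exact/asboolP.
  rewrite fpowersetE; apply/fsubsetP=> C CF; rewrite fpowersetE.
  by case: hF => /(_ _ CF) [].
by apply/bigmax_leqP_seq => Fam _ /asboolP; apply: h.
Qed.

Definition disjoint_family (Fam : {fset {fset M}}) : Prop :=
  forall C C', C \in Fam -> C' \in Fam -> C <> C' -> [disjoint C & C'].

Lemma card_disjoint_family (Fam : {fset {fset M}}) (U : {fset M}) :
  disjoint_family Fam -> (forall C, C \in Fam -> exists2 x, x \in C & x \in U) ->
  (#|` Fam| <= #|` U|)%N.
Proof.
move=> hd hm.
have /choice[u hu] : forall C : Fam, exists x, x \in val C /\ x \in U.
  by move=> C; have [x h1 h2] := hm _ (valP C); exists x.
have inj_u : injective u.
  move=> C C' e; apply/val_inj; apply: contrapT => ne.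
  have := hd _ _ (valP C) (valP C') ne => /fdisjointP /(_ _ (hu C).1).
  by rewrite e (hu C').1.
have <- : #|` [fset u C | C : Fam]| = #|` Fam|.
  by rewrite card_imfset //= cardfE cardE.
apply: fsubset_leq_card; apply/fsubsetP=> _ /imfsetP[C _ ->]; exact: (hu C).2.
Qed.

Lemma card_bigfcup_le (s : seq {fset M}) n : (forall T, T \in s -> (#|` T| <= n)%N) ->
  (#|` \bigcup_(T <- s) T| <= n * size s)%N.
Proof.
elim: s => [|T s IH] h; first by rewrite big_nil cardfs0.
rewrite big_cons cardfsU /= mulnS; apply: leq_trans (leq_subr _ _) _.
apply: leq_add; first by apply: h; rewrite inE eqxx.
by apply: IH => T' hT'; apply: h; rewrite inE hT' orbT.
Qed.

(** Each member owns a point of the union of [W], and a triple supplies at most three points. *)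
Lemma card_family_meeting (Fam W : {fset {fset M}}) : psts M ->
  disjoint_family Fam -> (forall T, T \in W -> triple T) ->
  (forall C, C \in Fam -> exists2 T, T \in W & exists2 x, x \in C & x \in T) ->
  (#|` Fam| <= 3 * #|` W|)%N.
Proof.
move=> pM hd hW hm.
apply: leq_trans (card_disjoint_family (U := \bigcup_(T <- W) T) hd _) _.
  move=> C /hm[T TW [x xC xT]]; exists x => //.
  by apply/bigfcupP; exists T => //; rewrite TW.
by apply: card_bigfcup_le => T /hW /(triple_card pM) ->.
Qed.

Lemma disjoint_copies_sub A B (p : good_pair) (f : substructure (gp_base p) -> M) Fam :
  disjoint_copies A f Fam -> (forall C, C \in Fam -> C `<=` B) ->
  disjoint_copies B f Fam.
Proof.
move=> [h1 h2] hB; split=> // C CF; split; first exact: hB.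
by have [_] := h1 _ CF.
Qed.

Lemma K_mu_sub mu A B : A `<=` B -> K_mu mu B -> K_mu mu A.
Proof.
move=> AB [[[hd hs hu] h0] hc]; split.
  split; last by move=> X XA; apply: h0; exact: fsubset_trans AB.
  have inB (x : A) : val x \in B by apply: (fsubsetP AB); exact: valP.
  pose i (x : A) : B := [` inB x].
  split=> [x y z r|x y z r|x y z w r1 r2 zw].
  - have [h1 h2 h3] := hd (i x) (i y) (i z) r.
    by split=> e; [apply: h1 | apply: h2 | apply: h3]; apply: val_inj; rewrite /= e.
  - exact: (hs (i x) (i y) (i z) r).
  by apply: (hu (i x) (i y) (i z) (i w) r1 r2) => /(congr1 val) /= /val_inj.
move=> p f hf hA; apply: le_trans (hc p f hf _); last by move=> b; exact: (fsubsetP AB).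
rewrite lez_nat; apply/chi_leP => Fam hF.
have : (chi B f <= chi B f)%N by [].
move=> /chi_leP; apply; apply: (disjoint_copies_sub hF) => C CF.
by apply: fsubset_trans AB; have [/(_ _ CF)[]] := hF.
Qed.

Hypothesis pM : psts M.

Lemma K_muP s A : K_mu (mu_of s) A <->
  (forall X, X `<=` A -> 0 <= predim X) /\
  forall (p : good_pair) (f : substructure (gp_base p) -> M),
    embedding f -> (forall b, f b \in A) ->
    forall Fam, disjoint_copies A f Fam -> (#|` Fam| <= mu_bound s p)%N.
Proof.
split=> [[[_ h0] hc]|[h0 hc]]; split.
- by move=> X /h0; rewrite deltaE.
- move=> p f hf hA; apply/chi_leP; rewrite -lez_nat; exact: hc.
- split; last by move=> X /h0; rewrite deltaE.
  exact: psts_Kstar (psts_substructure pM A).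
by move=> p f hf hA; rewrite lez_nat; apply/chi_leP; exact: hc.
Qed.

Variables (A : {fset M}) (p : good_pair) (f : substructure (gp_base p) -> M).
Variable Fam : {fset {fset M}}.
Hypotheses (hf : embedding f) (hFam : disjoint_copies A f Fam).

Definition base_image : {fset M} := [fset f b | b : gp_base p].

Lemma base_imageE (g : gp_str p -> M) :
  (forall b, g (val b) = f b) -> base_image = g @` (gp_base p).
Proof.
move=> e; apply/fsetP=> t; apply/imfsetP/imfsetP => [[b _ ->]|[x /= xb ->]].
  by exists (val b); rewrite ?e //; exact: valP.
by exists [` xb] => //; rewrite -e.
Qed.

Lemma card_base_image : #|` base_image| = #|` gp_base p|.
Proof. by case: hf => hi _; rewrite card_imfset //= cardfE cardE. Qed.

Lemma copyP C : C \in Fam -> exists g : gp_str p -> M,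
  [/\ embedding g, forall b, g (val b) = f b, C = g @` gp_ext p & C `<=` A].
Proof. by move=> CF; have [CA [g [h1 h2 h3]]] := hFam.1 _ CF; exists g. Qed.

Lemma good_copy C : C \in Fam -> good base_image C.
Proof.
move=> /copyP[g [h1 h2 -> _]]; rewrite (base_imageE h2); apply: good_embedding => //.
apply: good_of_pair; first exact: psts_embedding h1 pM.
exact: gp_good.
Qed.

Lemma card_copy C : C \in Fam -> #|` C| = #|` gp_ext p|.
Proof. by move=> /copyP[g [[hi _] _ -> _]]; rewrite card_imfset. Qed.

Lemma copies_disjoint : disjoint_family Fam.
Proof. by case: hFam. Qed.

(** Each copy is the third point of a block through the same two base points, and that point is
    unique. *)
Lemma single_copy : #|` gp_ext p| = 1%N -> (#|` Fam| <= 1)%N.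
Proof.
move=> /eqP /cardfs1P[a ea].
rewrite leqNgt; apply/negP=> F2.
have [C CF] : exists C, C \in Fam by apply/fset0Pn; rewrite -cardfs_gt0; apply: ltnW.
have [C' ] : exists C', C' \in Fam `\ C.
  by apply/fset0Pn; rewrite -cardfs_gt0; move: F2; rewrite (cardfsD1 C) CF.
rewrite !inE => /andP[/eqP neC C'F].
have [g [gemb gf eC _]] := copyP CF; have [g' [g'emb g'f eC' _]] := copyP C'F.
apply: neC; rewrite eC eC' ea !imfset_fset1; congr [fset _].
have pp : psts (gp_str p) := psts_embedding gemb pM.
have [x [y [xb yb r]]] : exists x y : gp_str p,
    [/\ x \in gp_base p, y \in gp_base p & rel3 x y a].
  have [dj _ [e1 _] _] := good_of_pair pp (gp_good p); apply: good_point pp _ _.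
    by rewrite -ea.
  by rewrite -ea.
have [_ g'r] := g'emb.
have [_ _ hu] := pM; have [_ {}gr] := gemb.
have h1 := gf [` xb]; have h2 := gf [` yb].
have h3 := g'f [` xb]; have h4 := g'f [` yb]; rewrite /= in h1 h2 h3 h4.
apply: (hu (g x) (g y)); last exact/gr.
by rewrite h1 h2 -h3 -h4; exact/g'r.
Qed.

End Copies.

(** Bases and copies counted in the image lie inside it, so whole families of copies can be pulled
    back along [h] and counted in [A]. *)
Lemma K_mu_pemb s (M N : structure) (A : {fset M}) (h : M -> N) :
  psts M -> psts N -> pemb A h -> K_mu (mu_of s) A -> K_mu (mu_of s) (h @` A).
Proof.
move=> pM pN ph /(K_muP pM)[h0 hc]; have [hi hr] := ph.
pose pre (Y : {fset N}) := [fset x in A | h x \in Y].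
have preA Y : pre Y `<=` A by apply/fsubsetP=> x; rewrite !inE => /andP[].
have preK Y : Y `<=` h @` A -> h @` pre Y = Y.
  move=> YA; apply/fsetP=> t; apply/imfsetP/idP => [[x /=]|tY].
    by rewrite !inE => /andP[_ ?] ->.
  have /imfsetP[x /= xA ex] := fsubsetP YA t tY.
  by exists x => //; rewrite !inE /= xA -ex.
apply/(K_muP pN); split.
  move=> Y YA; rewrite -(preK Y YA) predim_pemb; first exact: h0.
  exact: pemb_sub ph.
move=> p f hf hA Fam hF.
have /choice[f' hf'] : forall b, exists x, x \in A /\ f b = h x.
  by move=> b; have /imfsetP[x /= ? ?] := hA b; exists x.
have f'emb : embedding f'.
  have [fi fr] := hf; split.
    by move=> b b' e; apply: fi; rewrite (hf' b).2 (hf' b').2 e.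
  move=> a b c; apply: (iff_trans (fr a b c)).
  rewrite (hf' a).2 (hf' b).2 (hf' c).2; apply: iff_sym.
  by apply: hr; [exact: (hf' a).1 | exact: (hf' b).1 | exact: (hf' c).1].
have FA C : C \in Fam -> C `<=` h @` A by move=> /hF.1[].
have <- : #|` [fset pre C | C in Fam]| = #|` Fam|.
  apply: card_in_imfset => C C' /= /FA CA /FA C'A e.
  by rewrite -(preK _ CA) -(preK _ C'A) e.
apply: (hc p f' f'emb); first by move=> b; exact: (hf' b).1.
split; last first.
  move=> _ _ /imfsetP[C /= CF ->] /imfsetP[C' /= C'F ->] ne.
  have /fdisjointP hd : [disjoint C & C'].
    by apply: hF.2 => // e; apply: ne; rewrite e.
  by apply/fdisjointP=> x; rewrite !inE /= => /andP[-> /hd].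
move=> _ /imfsetP[C /= CF ->]; split; first exact: preA.
have [CA [g [gemb gf eC]]] := hF.1 _ CF.
have /choice[g' hg'] : forall i, exists x, x \in A /\ g i = h x.
  move=> i; have [iB|iB] := boolP (i \in gp_base p).
    by exists (f' [` iB]); rewrite -(hf' [` iB]).2 -gf; split=> //; exact: (hf' _).1.
  have /(fsubsetP CA)/imfsetP[x /= xA ex] : g i \in C.
    by rewrite eC in_imfset //= !inE iB.
  by exists x.
exists g'; split.
- have [gi gr] := gemb; split.
    by move=> i j e; apply: gi; rewrite (hg' i).2 (hg' j).2 e.
  move=> a b c; apply: (iff_trans (gr a b c)).
  rewrite (hg' a).2 (hg' b).2 (hg' c).2; apply: iff_sym.
  by apply: hr; [exact: (hg' a).1 | exact: (hg' b).1 | exact: (hg' c).1].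
- move=> b; apply: hi; [exact: (hg' _).1 | exact: (hf' _).1 |].
  by rewrite -(hg' _).2 -(hf' _).2 gf.
apply: (pemb_imfset_inj hi (preA _)).
  by apply/fsubsetP=> _ /imfsetP[i _ ->]; exact: (hg' i).1.
rewrite preK // eC; apply/fsetP=> t; apply/imfsetP/imfsetP => -[i /=].
  by move=> hi' ->; exists (g' i); [apply/imfsetP; exists i | exact: (hg' i).2].
by move=> /imfsetP[j /= hj ->] ->; exists j => //; rewrite (hg' j).2.
Qed.

(** * The one-block pair [alpha] on three points *)

Definition alpha_rel (i j k : 'I_3) : Prop := [/\ i <> j, i <> k & j <> k].
Definition alpha_base : {fset finstr alpha_rel} :=
  [fset (inord 0 : 'I_3); (inord 1 : 'I_3)].

Lemma ord3E (i : 'I_3) : [\/ i = inord 0, i = inord 1 | i = inord 2].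
Proof.
by case: i => [[|[|[|//]]] hi]; [apply: Or31 | apply: Or32 | apply: Or33];
  apply: val_inj; rewrite /= inordK.
Qed.

Lemma ord3_neq : [/\ (inord 0 : 'I_3) != inord 1, (inord 0 : 'I_3) != inord 2
  & (inord 1 : 'I_3) != inord 2].
Proof. by split; apply/eqP => /(congr1 val); rewrite /= !inordK. Qed.

Lemma alpha_psts : psts (finstr alpha_rel).
Proof.
split=> [x y z [? ? ?]|x y z [? ? ?]|x y z w [h1 h2 h3] [_ h4 h5]].
- by split.
- by split; split=> //; exact: nesym.
by move: h1 h2 h3 h4 h5; case: (ord3E x) (ord3E y) (ord3E z) (ord3E w)
  => -> [] -> [] -> [] -> //.
Qed.

Lemma alpha_ext : [fset x | x : 'I_3] `\` alpha_base = [fset (inord 2 : 'I_3)].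
Proof.
have [n1 n2 n3] := ord3_neq.
apply/fsetP=> t; rewrite !inE /=.
by case: (ord3E t) => ->; rewrite ?eqxx ?(negPf n1) ?(negPf n2) ?(negPf n3) //=
  ?orbT ?(eq_sym (inord 2)) ?(negPf n2) ?(negPf n3).
Qed.

Lemma alpha_predim (X : {fset finstr alpha_rel}) :
  X `<=` alpha_base `|` [fset (inord 2 : 'I_3)] ->
  (#|` X| <= 2)%N /\ predim X = (#|` X|)%:Z \/ (#|` X| = 3)%N /\ predim X = 2.
Proof.
have [n1 n2 n3] := ord3_neq; have pa := alpha_psts => sX.
have c3 : #|` alpha_base `|` [fset (inord 2 : 'I_3)]| = 3%N.
  by rewrite fsetUC cardfsU1 cardfs2 !inE negb_or !(eq_sym (inord 2)) n1 n2 n3.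
have cX := fsubset_leq_card sX; rewrite c3 in cX.
have [X2|X2] := leqP #|` X| 2; [left|right]; split=> //.
- suff -> : predim X = (#|` X|)%:Z - (#|` @fset0 {fset finstr alpha_rel}|)%:Z.
    by rewrite cardfs0 subr0.
  rewrite /predim; congr (_ - (#|` _|)%:Z); apply/fsetP=> T; rewrite in_fset0.
  apply/negP=> /blocksP[/fsubset_leq_card cT /(triple_card pa) e].
  by move: cT; rewrite e; lia.
- lia.
have eX : X = alpha_base `|` [fset (inord 2 : 'I_3)].
  by apply/eqP; rewrite eqEfcard sX c3.
suff -> : predim X = (#|` X|)%:Z - (#|` [fset X]|)%:Z.
  by rewrite cardfs1 eX c3.
rewrite /predim; congr (_ - (#|` _|)%:Z); apply/fsetP=> T; rewrite in_fset1.
apply/idP/eqP => [/blocksP[sT /(triple_card pa) cT]|->].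
  by apply/eqP; rewrite eqEfcard sT cT.
rewrite {1}eX; apply: mem_blocks; rewrite ?eX ?inE ?eqxx ?orbT //.
by split; apply/eqP.
Qed.

Lemma alpha_good : is_good_pair alpha_base ([fset x | x : 'I_3] `\` alpha_base).
Proof.
have [n1 n2 n3] := ord3_neq; have pa := alpha_psts.
have dj : [disjoint alpha_base & [fset (inord 2 : 'I_3)]].
  by rewrite fdisjointX1 !inE negb_or !(eq_sym (inord 2)) n2 n3.
have cb : #|` alpha_base| = 2%N by rewrite cardfs2 n1.
have cU : #|` alpha_base `|` [fset (inord 2 : 'I_3)]| = 3%N.
  by rewrite fsetUC cardfsU1 cardfs2 !inE negb_or !(eq_sym (inord 2)) n1 n2 n3.
rewrite alpha_ext; split.
  apply/(zero_primitiveP pa); split=> //.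
  - by move=> /fsetP /(_ (inord 2)); rewrite !inE eqxx.
  - by move=> X /alpha_predim[[_ ->]|[_ ->]].
  split.
    case: (alpha_predim (fsubset_refl _)) => -[]; rewrite cU // => _ ->.
    by case: (alpha_predim (fsubsetUl _ _)) => -[]; rewrite cb // => _ ->.
  by move=> Y; rewrite fsubset1 => /orP[] /eqP.
move=> [B' [pB' /(zero_primitiveP pa)[dj' _ _ [e1 _]]]].
have [x [y [xB yB [xy _ _]]]] := good_point pa dj' e1.
move: pB'; rewrite fproperEcard cb => /andP[/fsubsetP sB].
have : [fset x; y] `<=` B' by apply/fsubsetP=> t; rewrite !inE => /orP[] /eqP->.
by move/fsubset_leq_card; rewrite cardfs2; move/eqP: xy => -> /=; lia.
Qed.

Definition alpha : good_pair := GoodPair alpha_good.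

(** Two distinct third points [z] and [w] of a pair would be two disjoint copies for [alpha] over
    that pair, where mu allows one. *)
Lemma psts_of_K_mu s (M : structure) :
  (forall A : {fset M}, K_mu (mu_of s) A) -> psts M.
Proof.
move=> hK.
have hd (x y z : M) : rel3 x y z -> [/\ x <> y, x <> z & y <> z].
  move=> r; have [[[h _ _] _] _] := hK [fset x; y; z].
  have [hx hy hz] : [/\ x \in [fset x; y; z], y \in [fset x; y; z]
    & z \in [fset x; y; z]] by rewrite !inE !eqxx !orbT.
  have [h1 h2 h3] := h [` hx] [` hy] [` hz] r.
  by split=> e; [apply: h1|apply: h2|apply: h3]; apply: val_inj.
have hs (x y z : M) : rel3 x y z -> rel3 y x z /\ rel3 x z y.
  move=> r; have [[[_ h _] _] _] := hK [fset x; y; z].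
  have [hx hy hz] : [/\ x \in [fset x; y; z], y \in [fset x; y; z]
    & z \in [fset x; y; z]] by rewrite !inE !eqxx !orbT.
  exact: (h [` hx] [` hy] [` hz] r).
split=> // x y z w rz rw; apply: contrapT => zw.
have [xy xz yz] := hd _ _ _ rz; have [_ xw yw] := hd _ _ _ rw.
have [n1 n2 n3] := ord3_neq.
pose A := [fset x; y; z; w].
pose g (c : M) (i : gp_str alpha) : M :=
  match nat_of_ord (i : 'I_3) with 0 => x | 1 => y | _ => c end.
have g0 c : g c (inord 0 : 'I_3) = x by rewrite /g inordK.
have g1 c : g c (inord 1 : 'I_3) = y by rewrite /g inordK.
have g2 c : g c (inord 2 : 'I_3) = c by rewrite /g inordK.
have gemb c : rel3 x y c -> embedding (g c).
  move=> r; have [_ xc yc] := hd _ _ _ r; split.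
    move=> i j; case: (ord3E i) (ord3E j) => -> [] ->; rewrite ?g0 ?g1 ?g2 //;
      by move=> e; case: xy + case: xc + case: yc.
  move=> i j k; split.
    have [r1 r2] := hs _ _ _ r; have [_ r3] := hs _ _ _ r1.
    have [r4 _] := hs _ _ _ r2; have [r5 _] := hs _ _ _ r3.
    move=> [h1 h2 h3]; move: h1 h2 h3.
    by case: (ord3E i) (ord3E j) (ord3E k) => -> [] -> [] -> //; rewrite ?g0 ?g1 ?g2.
  by move=> /hd[h1 h2 h3]; split=> e; [apply: h1|apply: h2|apply: h3]; rewrite e.
pose f (b : substructure (gp_base alpha)) : M := g z (val b).
have femb : embedding f.
  have [gi gr] := gemb z rz; split=> [a b /gi e|a b c]; first exact: val_inj.
  exact: gr.
have [_ /(_ alpha f femb) hc] := hK A.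
have vb (b : substructure (gp_base alpha)) :
    val b = (inord 0 : 'I_3) \/ val b = (inord 1 : 'I_3).
  by have := valP b; rewrite !inE => /orP[] /eqP; [left|right].
have : (chi A f)%:Z <= mu_of s alpha.
  by apply: hc => b; rewrite /f; case: (vb b) => ->; rewrite ?g0 ?g1 !inE eqxx ?orbT.
have ext_a : gp_ext alpha = [fset (inord 2 : 'I_3)] := alpha_ext.
have e1 : mu_bound s alpha = 1%N by rewrite /mu_bound ext_a cardfs1.
have -> : (mu_of s alpha) = 1%N :> int by rewrite /mu_of e1.
rewrite lez_nat => /chi_leP.
move=> /(_ [fset [fset z]; [fset w]]); rewrite cardfs2.
have -> : [fset z] != [fset w].
  by apply/eqP=> /fsetP /(_ z); rewrite !inE eqxx => /esym /eqP.
move=> h; suff : (2 <= 1)%N by []; apply: h; split.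
  move=> C; rewrite !inE => /orP[] /eqP ->; (split;
    [by rewrite fsub1set !inE eqxx ?orbT | ]).
    by exists (g z); split; [exact: gemb|by []|rewrite ext_a imfset_fset1 g2].
  exists (g w); split; [exact: gemb| |by rewrite ext_a imfset_fset1 g2].
  by move=> b; rewrite /f; case: (vb b) => ->; rewrite ?g0 ?g1.
move=> C C'; rewrite !inE => /orP[] /eqP-> /orP[] /eqP-> // _; rewrite fdisjointX1 inE.
  by apply/eqP=> e; apply: zw.
by apply/eqP=> e; apply: zw.
Qed.

(** * Gluing and amalgamation *)

(* The atoms are abstracted first because [lia] treats convertible but
   syntactically different instances as distinct. *)
Ltac card_lia :=
  repeat match goal with
  | |- context [predim ?X] => move: (predim X) => ?
  | |- context [#|` ?X|] => move: #|` X| => ?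
  end; clear; lia.

(** This locates copies: whenever cutting a copy down to some region does not raise the predimension
    over the base, the copy lies inside the region or misses it. *)
Lemma good_dichotomy (M : structure) (E F Y : {fset M}) : good E F -> Y `<=` F ->
  predim (E `|` Y) <= predim (E `|` F) -> Y = fset0 \/ Y = F.
Proof.
move=> [_ _ [e hlt] _] YF; rewrite e => hle; apply: contrapT => /not_orP[Y0 Y1].
by have := hlt Y YF Y0 Y1; rewrite ltNge hle.
Qed.

(* [E `|` F] has [#|F|] more blocks than [E], which is all that
   [predim A <= predim (A `|` F)] allows [A `|` F] to have beyond those of [A]. *)
Lemma block_over_base (M : structure) (A E F T : {fset M}) :
  E `<=` A -> [disjoint A & F] -> predim (E `|` F) = predim E ->
  predim A <= predim (A `|` F) -> T \in blocks (A `|` F) ->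
  T `<=` A \/ T `<=` E `|` F.
Proof.
move=> EA dj e hle hT.
have iE : A `&` (E `|` F) = E.
  apply/fsetP=> t; rewrite !inE; apply/andP/idP => [[tA /orP[//|tF]]|tE].
    by have := fdisjointP dj t tA; rewrite tF.
  by rewrite (fsubsetP EA) // tE.
have djE : E `&` F = fset0 by apply/eqP; apply: fdisjointWl dj.
have djA : A `&` F = fset0 by apply/eqP.
have sub : blocks A `|` blocks (E `|` F) `<=` blocks (A `|` F).
  rewrite fsubUset !blocks_sub ?fsubsetUl //; exact: fsetSU.
have : #|` blocks A `|` blocks (E `|` F)| = #|` blocks (A `|` F)|.
  apply/eqP; rewrite eqn_leq fsubset_leq_card //=.
  have := cardfsUI (blocks A) (blocks (E `|` F)); rewrite -blocksI iE.
  have := cardfsUI E F; have := cardfsUI A F; rewrite djE djA cardfs0.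
  by move: e hle; rewrite /predim; card_lia.
move=> /eqP; rewrite eqn_leq => /andP[_ h].
have e2 : blocks A `|` blocks (E `|` F) = blocks (A `|` F).
  by apply/eqP; rewrite eqEfcard sub h.
by move: hT; rewrite -e2 in_fsetU => /orP[] /blocksP[]; [left|right].
Qed.

(** By [block_over_base], applied in the source and in the target, no block mixes the two pieces
    outside [E]; each block is therefore handled by [h] or by [k] alone. *)
Lemma pemb_glue (M1 M2 : structure) (A E F : {fset M1}) (h k : M1 -> M2) :
  E `<=` A -> [disjoint A & F] -> pemb A h -> pemb (E `|` F) k ->
  {in E, k =1 h} -> [disjoint h @` A & k @` F] ->
  predim (E `|` F) = predim E -> predim A <= predim (A `|` F) ->
  predim (h @` A) <= predim (h @` A `|` k @` F) ->
  pemb (A `|` F) (fun x => if x \in A then h x else k x).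
Proof.
move=> EA dj ph pk ekh dj' e hle hle'.
have [hi hr] := ph; have [ki kr] := pk.
set h' := fun x => _.
have h'A x : x \in A -> h' x = h x by rewrite /h' => ->.
have h'F x : x \in F -> h' x = k x.
  by rewrite /h' => xF; case: ifP => // /(fdisjointP dj); rewrite xF.
have h'EF x : x \in E `|` F -> h' x = k x.
  by rewrite inE => /orP[xE|/h'F//]; rewrite h'A ?ekh //; exact: (fsubsetP EA).
have kh x y : x \in A -> y \in F -> h x <> k y.
  move=> xA yF exy; have := fdisjointP dj' (h x); rewrite in_imfset //= => /(_ isT).
  by rewrite exy in_imfset.
have sub3 (N : structure) (x y z : N) (B : {fset N}) :
    [fset x; y; z] `<=` B -> [/\ x \in B, y \in B & z \in B].
  by move=> /fsubsetP sB; split; apply: sB; rewrite !inE eqxx ?orbT.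
split.
  move=> x y; rewrite !inE => /orP[xA|xF] /orP[yA|yF];
    rewrite ?(h'A _ xA) ?(h'A _ yA) ?(h'F _ xF) ?(h'F _ yF).
  - exact: hi.
  - by move/kh; case.
  - by move/esym/kh; case.
  - by apply: ki; rewrite inE ?xF ?yF orbT.
move=> x y z xU yU zU; split=> r.
  have /(block_over_base EA dj e hle) := mem_blocks r xU yU zU.
  case=> /(sub3 _ _ _ _ _)[hx hy hz].
    by rewrite !h'A //; apply/hr.
  by rewrite !h'EF //; apply/kr.
have mem' t : t \in A `|` F -> h' t \in h @` A `|` k @` F.
  rewrite !inE => /orP[tA|tF]; first by rewrite h'A // in_imfset.
  by rewrite h'F // in_imfset ?orbT.
have EA' : k @` E `<=` h @` A.
  apply/fsubsetP=> _ /imfsetP[t /= tE ->]; rewrite ekh // in_imfset //=.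
  exact: (fsubsetP EA).
have e' : predim (k @` E `|` k @` F) = predim (k @` E).
  by rewrite -imfsetU !predim_pemb //; apply: pemb_sub pk; exact: fsubsetUl.
have inA t : t \in A `|` F -> h' t \in h @` A -> t \in A.
  rewrite inE => /orP[//|tF]; rewrite h'F // => /imfsetP[u /= uA eu].
  by case: (kh u t uA tF).
have inEF t : t \in A `|` F -> h' t \in k @` E `|` k @` F -> t \in E `|` F.
  rewrite !inE => /orP[tA|->]; last by rewrite orbT.
  rewrite h'A // => /orP[] /imfsetP[u /= uin]; last by move/(kh _ _ tA uin).
  rewrite ekh // => /(hi _ _ tA (fsubsetP EA _ uin)) ->.
  by rewrite uin.
have /(block_over_base EA' dj' e' hle') :=
  mem_blocks r (mem' _ xU) (mem' _ yU) (mem' _ zU).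
case=> /(sub3 _ _ _ _ _)[hx hy hz].
  by apply/hr; rewrite -?h'A //; exact: inA.
by apply/kr; rewrite -?h'EF //; exact: inEF.
Qed.

Section Extension.
Variables (s : nat -> bool) (M : structure).
Hypothesis pM : psts M.
Implicit Types A B E F S T X Y C : {fset M}.

Lemma family_bound_sub X S (p : good_pair) (f : substructure (gp_base p) -> M) Fam :
  embedding f -> disjoint_copies X f Fam -> K_mu (mu_of s) S ->
  base_image f `<=` S -> (forall C, C \in Fam -> C `<=` S) ->
  (#|` Fam| <= mu_bound s p)%N.
Proof.
move=> hf hF /(K_muP pM)[_ hc] hE hC; apply: (hc p f hf) => [b|].
  by apply: (fsubsetP hE); apply/imfsetP; exists b.
exact: disjoint_copies_sub hF hC.
Qed.

Lemma base_image_sub X (p : good_pair) (f : substructure (gp_base p) -> M) :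
  (forall b, f b \in X) -> base_image f `<=` X.
Proof. by move=> h; apply/fsubsetP=> _ /imfsetP[b _ ->]. Qed.

(** Removing [c] never raises the predimension, so by [good_dichotomy] no copy with at least two
    points contains [c]. If [c] is in the base, every copy uses a new block; there is at most one,
    and it meets at most three copies. Otherwise base and copies lie in [A]. *)
Lemma K_mu_add_point A c : c \notin A -> K_mu (mu_of s) A ->
  (#|` blocks (c |` A) `\` blocks A| <= 1)%N -> K_mu (mu_of s) (c |` A).
Proof.
move=> cA hK hW; have [h0 _] := (K_muP pM _ _).1 hK.
have hle X : X `<=` c |` A -> predim (X `\ c) <= predim X.
  move=> XA; have eI : X `&` A = X `\ c.
    apply/fsetP=> t; have := fsubsetP XA t; rewrite !inE.
    have [->|_] := eqVneq t c; first by rewrite (negPf cA) andbF.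
    by case: (t \in X) => //= /(_ isT) ->.
  have := predim_submod X A; rewrite eI.
  have [cX|cX] := boolP (c \in X); last by rewrite mem_fsetD1.
  have -> : X `|` A = c |` A.
    apply/fsetP=> t; have := fsubsetP XA t; rewrite !inE.
    by have [->|_] := eqVneq t c; [rewrite cX|case: (t \in X) => //= /(_ isT) ->].
  have := cardfsID (blocks A) (blocks (c |` A)); move: hW.
  have /fsetIidPr -> : blocks A `<=` blocks (c |` A) by apply: blocks_sub; exact: fsubsetUr.
  have := cardfsU1 c A; rewrite cA /= /predim; card_lia.
apply/(K_muP pM); split.
  move=> X XA; apply: le_trans (hle X XA); apply: h0.
  apply/fsubsetP=> t; rewrite !inE => /andP[tc] /(fsubsetP XA).
  by rewrite !inE (negPf tc).
move=> p f hf hA Fam hF.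
have [e1|e1] := eqVneq #|` gp_ext p| 1%N.
  by rewrite /mu_bound e1; exact: (single_copy pM hF).
have hg C (CF : C \in Fam) := good_copy pM hF CF.
have FA C : C \in Fam -> C `<=` c |` A by move=> /hF.1[].
have EA := base_image_sub hA.
have cC C : C \in Fam -> c \notin C.
  move=> CF; apply/negP=> cC; have [dj C0 _ _] := hg C CF.
  have cE : c \notin base_image f.
    by apply/negP=> /(fdisjointP dj); rewrite cC.
  have e2 : (base_image f `|` C) `\ c = base_image f `|` (C `\ c).
    by rewrite fsetDUl mem_fsetD1.
  case: (good_dichotomy (hg C CF) (fsubD1set C c)).
  - by rewrite -e2; apply: hle; rewrite fsubUset EA FA.
  - move=> e; move: e1; rewrite -(card_copy hF CF) (cardfsD1 c) cC e.
    by rewrite cardfs0.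
  by move=> e; move: cC; rewrite -e !inE eqxx.
have [cE|cE] := boolP (c \in base_image f).
  rewrite /mu_bound (negPf e1).
  have -> : (gp_base p == fset0) = false.
    by rewrite -cardfs_eq0 -(card_base_image hf); apply/eqP=> /cardfs0_eq e; rewrite e in cE.
  apply: (@leq_trans (3 * 1)%N); last by lia.
  apply: leq_trans (card_family_meeting pM (copies_disjoint hF)
    (W := blocks (c |` A) `\` blocks A) _ _) _; last by rewrite leq_mul2l.
    by move=> T; rewrite !in_fsetD => /andP[_ /blocksP[]].
  move=> C CF; have [_ _ _ hb] := hg C CF.
  have [T hT [cT [y yC yT]]] := hb c cE.
  exists T; last by exists y.
  rewrite in_fsetD; apply/andP; split.
    by apply/negP=> /blocksP[/fsubsetP /(_ c cT)]; rewrite (negPf cA).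
  by apply: (fsubsetP (blocks_sub _)) hT; rewrite fsubUset EA FA.
apply: (family_bound_sub hf hF hK).
  apply/fsubsetP=> t tE; have := fsubsetP EA t tE; rewrite !inE => /orP[/eqP tc|//].
  by rewrite tc in tE; rewrite tE in cE.
move=> C CF; apply/fsubsetP=> t tC; have := fsubsetP (FA C CF) t tC.
rewrite !inE => /orP[/eqP tc|//].
by have := cC C CF; rewrite -tc tC.
Qed.

(** * Free amalgams over [A], with [N] on one side *)

Variables (A N : {fset M}).
Hypotheses (dAN : [disjoint A & N])
  (h1 : forall T, triple T -> T `<=` A `|` N \/ [disjoint T & N])
  (h2 : forall X, [disjoint X & N] -> K_mu (mu_of s) X)
  (h3 : K_mu (mu_of s) (A `|` N))
  (h4 : predim A <= predim (A `|` N))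
  (h4' : forall Y, Y `<=` N -> Y <> fset0 -> Y <> N -> predim A < predim (A `|` Y))
  (h5 : forall X, A `<=` X -> [disjoint X & N] -> predim A <= predim X).

Lemma amalgam_le Y : Y `<=` N -> predim A <= predim (A `|` Y).
Proof.
move=> YN; have [->|/eqP Y0] := eqVneq Y fset0; first by rewrite fsetU0.
by have [->//|/eqP Y1] := eqVneq Y N; apply/ltW/h4'.
Qed.

Lemma amalgam_free X :
  predim X + predim (X `&` A) = predim (X `\` N) + predim (X `&` (A `|` N)).
Proof.
have e1 : (X `\` N) `|` (X `&` (A `|` N)) = X.
  by apply/fsetP=> t; rewrite !inE; case: (t \in X); case: (t \in N); rewrite ?orbT.
have e2 : (X `\` N) `&` (X `&` (A `|` N)) = X `&` A.
  apply/fsetP=> t; have := fdisjointP dAN t; rewrite !inE.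
  by case: (t \in X); case: (t \in A) => //= h; rewrite ?(h isT) //; case: (t \in N).
have := @predim_free M (X `\` N) (X `&` (A `|` N)); rewrite e1 e2; apply=> T.
move=> /blocksP[TX tT]; case: (h1 tT) => hT; [right|left].
  by rewrite fsubsetI TX.
apply/fsubsetP=> t tT'; rewrite inE (fdisjointP hT) //; exact: (fsubsetP TX).
Qed.

(** By freeness the part of [X] in [N] costs over the rest of [X] what it costs over the trace of
    [X] on [A]; by submodularity this is at least its cost over all of [A], which is nonnegative. *)
Lemma amalgam_strong_old X : predim (X `\` N) <= predim X.
Proof.
have := amalgam_free X; have := predim_submod A (X `&` (A `|` N)).
have -> : A `|` (X `&` (A `|` N)) = A `|` (X `&` N).
  by apply/fsetP=> t; rewrite !inE; case: (t \in X); case: (t \in A).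
have -> : A `&` (X `&` (A `|` N)) = X `&` A.
  by apply/fsetP=> t; rewrite !inE; case: (t \in X); case: (t \in A).
have := amalgam_le (fsubsetIr X N); lia.
Qed.

Lemma amalgam_strong_new X : predim (X `&` (A `|` N)) <= predim X.
Proof.
have := amalgam_free X; have := predim_submod A (X `\` N).
have -> : A `&` (X `\` N) = X `&` A.
  apply/fsetP=> t; have := fdisjointP dAN t; rewrite !inE.
  by case: (t \in X); case: (t \in A) => //= h; rewrite ?h //; case: (t \in N).
have := h5 (fsubsetUl A (X `\` N)).
have -> : [disjoint A `|` X `\` N & N].
  rewrite fdisjointUX dAN; apply/fdisjointP=> t; by rewrite !inE => /andP[].
by move=> /(_ isT); lia.
Qed.

(* The copies meeting [N] lower the predimension one by one, the others consume
   a block through a point of [E] lying in [N]; both resources are bounded by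
   the number of points of [E] in [N]. *)
Lemma straddling_bound E (Fam : {fset {fset M}}) :
  disjoint_family Fam -> (forall C, C \in Fam -> good E C) ->
  ~ [disjoint E & N] -> ~ (E `<=` A `|` N) -> (#|` Fam| <= 3 * #|` E|)%N.
Proof.
move=> hd hg hEN hEB.
have [e1 e1E e1N] : exists2 e1, e1 \in E & e1 \in N.
  apply: contrapT => h; apply: hEN; apply/fdisjointP=> t tE; apply/negP=> tN.
  by apply: h; exists t.
have [e2 e2E e2B] : exists2 e2, e2 \in E & e2 \notin A `|` N.
  apply: contrapT => h; apply: hEB; apply/fsubsetP=> t tE; apply: contrapT => /negP tB.
  by apply: h; exists t.
pose P := \bigcup_(C <- Fam) C.
have inP C : C \in Fam -> C `<=` P.
  by move=> CF; apply/fsubsetP=> t tC; apply/bigfcupP; exists C; rewrite ?CF.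
have dEP t : t \in E -> t \notin P.
  move=> tE; apply/negP=> /bigfcupP[C]; rewrite andbT => CF tC.
  by have [dj _ _ _] := hg C CF; have := fdisjointP dj t tE; rewrite tC.
(* The count closes as |G| <= predim X0 - predim X1 <= predim X0 - predim Z <= |E| - |W| together
   with |H| <= 3|W|. *)
pose X1 := E `|` P; pose X0 := E `|` (P `\` N); pose Z := X1 `\` N.
pose G := [fset C in Fam | ~~ [disjoint C & N]%fset].
pose H := [fset C in Fam | [disjoint C & N]%fset].
pose W := [fset T in blocks X0 | ~~ [disjoint T & N]%fset].
(* A block joining [e2] to the copy is not inside A u N, so it avoids [N] and its point in the copy
   lies outside [N]. *)
have notN C : C \in Fam -> C `\` N <> fset0.
  move=> CF; have [_ _ _ hb] := hg C CF.
  have [T hT [eT [y yC yT]]] := hb e2 e2E.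
  case: (h1 (blocksP _ _ hT).2) => hT'.
    by move=> _; have := fsubsetP hT' _ eT; rewrite (negPf e2B).
  move=> e0; have : y \in C `\` N by rewrite inE yC andbT; exact: (fdisjointP hT').
  by rewrite e0.
(* The part of [C] outside [N] is proper and nonempty, so completing it to [C] lowers the
   predimension over [E] by at least one; submodularity carries this drop over to [Y]. *)
have stepdown (l : seq {fset M}) Y : X0 `<=` Y -> uniq l ->
    (forall C, C \in l -> [/\ C \in Fam, ~~ [disjoint C & N]%fset & Y `&` C = C `\` N]) ->
    predim (Y `|` \bigcup_(C <- l) C) + (size l)%:Z <= predim Y.
  elim: l Y => [|C l IH] Y hY ul hl; first by rewrite big_nil fsetU0 addr0.
  have [CF nCN eYC] := hl C (mem_head _ _).
  have [dj C0 [e0 hlt] _] := hg C CF.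
  have hEY : E `<=` Y by apply: fsubset_trans hY; exact: fsubsetUl.
  have hC : predim E < predim (E `|` (C `\` N)).
    apply: hlt; [exact: fsubsetDl | exact: notN |] => e.
    by move: nCN; rewrite -e => /negP; apply; apply/fdisjointP=> t; rewrite inE => /andP[].
  have := predim_submod Y (E `|` C).
  have -> : Y `|` (E `|` C) = Y `|` C.
    by rewrite fsetUA (fsetUidPl _ _ hEY).
  have -> : Y `&` (E `|` C) = E `|` (C `\` N).
    by rewrite fsetIUr eYC (fsetIidPr hEY).
  rewrite e0 big_cons fsetUA /= => hs.
  have [ClN /= ul'] := andP ul.
  have : predim (Y `|` C `|` \bigcup_(C <- l) C) + (size l)%:Z <= predim (Y `|` C).
    apply: IH => //; first by apply: fsubset_trans hY _; exact: fsubsetUl.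
    move=> C' C'l; have [C'F nC'N eYC'] :
      [/\ C' \in Fam, ~~ [disjoint C' & N]%fset & Y `&` C' = C' `\` N].
      by apply: hl; rewrite inE C'l orbT.
    split=> //; rewrite fsetIUl eYC' (_ : C `&` C' = fset0) ?fsetU0 //.
    apply/eqP; apply: hd => // eC; by rewrite eC C'l in ClN.
  by move: hs hC; card_lia.
have a1 : predim X1 + (#|` G|)%:Z <= predim X0.
  have := stepdown G X0 (fsubset_refl _) (fset_uniq _).
  have -> : X0 `|` \bigcup_(C <- G) C = X1.
    apply/fsetP=> t; rewrite !in_fsetU in_fsetD.
    have [tE|tE] /= := boolP (t \in E); first by [].
    apply/orP/idP => [[/andP[]//|/bigfcupP[C]]|tP].
      by rewrite andbT !inE => /andP[/inP /fsubsetP h _] /h.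
    have [tN|tN] := boolP (t \in N); [right|by left; rewrite tP].
    have /bigfcupP[C] := tP; rewrite andbT => CF tC.
    apply/bigfcupP; exists C => //; rewrite andbT !inE CF /=.
    by apply/negP=> /fdisjointP /(_ t tC); rewrite tN.
  apply=> C; rewrite !inE => /andP[CF nCN]; split=> //.
  apply/fsetP=> t; rewrite !inE; have [tC|tC] := boolP (t \in C); last by rewrite !andbF.
  rewrite !andbT; have tP := fsubsetP (inP _ CF) t tC.
  rewrite tP andbT; have [tE|//] := boolP (t \in E).
  by have := dEP t tE; rewrite tP.
have a2 : predim Z <= predim X1 := amalgam_strong_old X1.
have eZ : Z = X0 `\` N.
  by apply/fsetP=> t; rewrite !inE; case: (t \in N); rewrite //= ?andbT.
have a3 : predim X0 + (#|` W|)%:Z <= predim Z + (#|` E|)%:Z.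
  have c1 : (#|` X0| <= #|` Z| + #|` E|)%N.
    have -> : X0 = Z `|` (E `&` N).
      apply/fsetP=> t; rewrite eZ !inE; case: (t \in N); case: (t \in E) => //=.
      by rewrite orbF.
    rewrite cardfsU; apply: leq_trans (leq_subr _ _) _; rewrite leq_add2l.
    exact: fsubset_leq_card (fsubsetIl _ _).
  have c2 : (#|` blocks Z| + #|` W| <= #|` blocks X0|)%N.
    have := cardfsUI (blocks Z) W.
    have -> : blocks Z `&` W = fset0.
      apply/fsetP=> T; rewrite in_fset0 in_fsetI; apply/negP=> /andP[/blocksP[TZ _]].
      rewrite !inE => /andP[_ /negP]; apply; apply/fdisjointP=> t /(fsubsetP TZ).
      by rewrite !inE => /andP[].
    rewrite cardfs0 addn0 => <-; apply: fsubset_leq_card; rewrite fsubUset.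
    apply/andP; split; first by apply: blocks_sub; rewrite eZ fsubsetDl.
    by apply/fsubsetP=> T; rewrite in_fset => /andP[].
  rewrite /predim; move: c1 c2; card_lia.
have a4 : (#|` H| <= 3 * #|` W|)%N.
  apply: card_family_meeting pM _ _ _.
  - by move=> C C'; rewrite !inE => /andP[? _] /andP[? _]; exact: hd.
  - by move=> T; rewrite in_fset => /andP[/blocksP[]].
  move=> C; rewrite in_fset => /andP[CF /= dCN].
  have [_ _ _ hb] := hg C CF; have [T hT [eT [y yC yT]]] := hb e1 e1E.
  exists T; last by exists y.
  rewrite in_fset; apply/andP; split; last first.
    by apply/negP=> /fdisjointP /(_ e1 eT); rewrite e1N.
  apply: (fsubsetP (blocks_sub _)) hT; apply: fsetUS; apply/fsubsetP=> t tC.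
  by rewrite inE (fdisjointP dCN) // (fsubsetP (inP _ CF)).
have a5 : #|` Fam| = (#|` G| + #|` H|)%N.
  have := cardfsUI G H.
  have -> : G `|` H = Fam.
    by apply/fsetP=> C; rewrite !inE; case: (C \in Fam) => //=; case: [disjoint _ & _]%fset.
  have -> : G `&` H = fset0; last by rewrite cardfs0 addn0.
  by apply/fsetP=> C; rewrite !inE; case: (C \in Fam) => //=; case: [disjoint _ & _]%fset.
by move: a1 a2 a3 a4 a5; card_lia.
Qed.

Lemma amalgam : (forall X, K_mu (mu_of s) X) \/
  exists h : M -> M, [/\ pemb (A `|` N) h, {in A, h =1 id},
    [disjoint h @` N & N] & predim (A `|` N) = predim A].
Proof.
have [|hn] := pselect (exists h : M -> M, [/\ pemb (A `|` N) h, {in A, h =1 id},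
  [disjoint h @` N & N] & predim (A `|` N) = predim A]); first by right.
left=> X.
have dD Y : [disjoint Y `\` N & N].
  by apply/fdisjointP=> t; rewrite inE => /andP[].
apply/(K_muP pM); split.
  move=> Y _; apply: le_trans (amalgam_strong_old Y).
  exact: ((K_muP pM _ _).1 (h2 (dD Y))).1.
move=> p f hf hX Fam hF; have EX := base_image_sub hX.
have [e1|e1] := eqVneq #|` gp_ext p| 1%N.
  by rewrite /mu_bound e1; exact: (single_copy pM hF).
have hg C (CF : C \in Fam) := good_copy pM hF CF.
have hd := copies_disjoint hF.
have FX C : C \in Fam -> C `<=` X by move=> /hF.1[].
have [dE|dE] := pselect [disjoint base_image f & N]; last first.
  have [EB|EB] := pselect (base_image f `<=` A `|` N); last first.
    apply: leq_trans (straddling_bound hd hg dE EB) _.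
    rewrite /mu_bound (negPf e1) card_base_image //.
    case: eqP => [e0|_]; last exact: leq_addr.
    case: dE; have -> : base_image f = fset0; last exact: fdisjoint0X.
    by apply: cardfs0_eq; rewrite card_base_image // e0 cardfs0.
  apply: (family_bound_sub hf hF h3 EB) => C CF.
  (* The side A u N is strong, so the copy lies in it or misses it. It cannot miss it: a block
     joining a base point in [N] to the copy meets [N] and so stays inside A u N. *)
  have [] := good_dichotomy (hg C CF) (fsubsetIl C (A `|` N)).
  - have := amalgam_strong_new (base_image f `|` C).
    by rewrite fsetIUl (fsetIidPl EB).
  - have [e eE eN] : exists2 e, e \in base_image f & e \in N.
      apply: contrapT => h; apply: dE; apply/fdisjointP=> t tE; apply/negP=> tN.
      by apply: h; exists t.
    have [_ _ _ hb] := hg C CF; have [T hT [eT [y yC yT]]] := hb e eE.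
    case: (h1 (blocksP _ _ hT).2) => [/fsubsetP /(_ y yT) yB e0|/fdisjointP /(_ e eT)].
      by have : y \in C `&` (A `|` N); [rewrite in_fsetI yC yB | rewrite e0].
    by rewrite eN.
  by move=> <-; exact: fsubsetIr.
have offN S : S `<=` X -> [disjoint S & N] -> S `<=` X `\` N.
  by move=> /fsubsetP SX /fdisjointP SN; apply/fsubsetP=> t tS; rewrite inE SN ?SX.
have [hall|[F1 [F1F F1N]]] : (forall C, C \in Fam -> [disjoint C & N]) \/
    exists F1, F1 \in Fam /\ ~ [disjoint F1 & N].
  have [|h] := pselect (forall C, C \in Fam -> [disjoint C & N]); first by left.
  by right; apply: contrapT => h'; apply: h => C CF; apply: contrapT => ?; apply: h'; exists C.
  apply: (family_bound_sub hf hF (h2 (dD X))); first exact: offN.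
  by move=> C CF; apply: offN; [exact: FX | exact: hall].
have split_N C : C \in Fam -> C `\` N = fset0 \/ C `\` N = C.
  move=> CF; apply: (good_dichotomy (hg C CF) (fsubsetDl C N)).
  by have := amalgam_strong_old (base_image f `|` C); rewrite fsetDUl (fsetDidPl _ _ dE).
have {}F1N : F1 `<=` N.
  case: (split_N F1 F1F) => [/eqP|e]; first by rewrite fsetD_eq0.
  by case: F1N; rewrite -e; exact: dD.
have [djF F10 [eF1 _] hb1] := hg F1 F1F.
(* A block joining a base point to [F1] meets [N], hence lies in A u N, and the base avoids [N]. *)
have EA : base_image f `<=` A.
  apply/fsubsetP=> e eE; have [T hT [eT [y yF1 yT]]] := hb1 e eE.
  case: (h1 (blocksP _ _ hT).2) => [/fsubsetP /(_ e eT)|/fdisjointP /(_ y yT)].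
    by rewrite inE => /orP[//|]; rewrite (negPf (fdisjointP dE e eE)).
  by rewrite (fsubsetP F1N).
have capE C : [disjoint A & C] -> A `&` (base_image f `|` C) = base_image f.
  by move=> /eqP dAC; rewrite fsetIUr dAC fsetU0; apply/fsetIidPr.
have cupE C : A `|` (base_image f `|` C) = A `|` C.
  by rewrite fsetUA (fsetUidPl _ _ EA).
(* Over [A] the set [F1] costs at most what it costs over the base, namely zero; by [h4'] it cannot
   be a proper part of [N]. *)
have {}F1N : F1 = N.
  apply: contrapT => ne; have := h4' F1N F10 ne.
  have := predim_submod A (base_image f `|` F1).
  rewrite capE ?cupE ?eF1; last exact: fdisjointWr dAN.
  by move=> h h'; move: h h'; card_lia.
rewrite {F1}F1N in F1F djF F10 eF1 hb1.
have eN : predim (A `|` N) = predim A.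
  have := predim_submod A (base_image f `|` N).
  rewrite capE // cupE eF1; move: h4; card_lia.
(* A copy [C] not contained in A u N turns out to be disjoint from [A] and from [N]. Carrying [N] to
   [C] while fixing [A] then gives the embedding excluded by [hn]. *)
have [hall|[C [CF CN CA]]] : (forall C, C \in Fam -> C `<=` A `|` N) \/
    exists C, [/\ C \in Fam, C <> N & ~ C `<=` A].
  have [|h] := pselect (forall C, C \in Fam -> C `<=` A `|` N); first by left.
  right; apply: contrapT => h'; apply: h => C CF; apply: contrapT => h.
  apply: h'; exists C; split=> // [eC|sC]; apply: h.
    by rewrite eC fsubsetUr.
  by apply: fsubset_trans sC _; exact: fsubsetUl.
  apply: (family_bound_sub hf hF h3) => //.
  by apply: fsubset_trans EA _; exact: fsubsetUl.
have dCN : [disjoint C & N] by apply: hd.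
have [djC C0 [eC _] _] := hg C CF.
have leC : predim A <= predim (A `|` C).
  by apply: h5; [exact: fsubsetUl | rewrite fdisjointUX dAN].
have dAC : [disjoint A & C].
  have [] := good_dichotomy (hg C CF) (fsubsetIr A C).
  - have := predim_submod A (base_image f `|` C).
    rewrite cupE fsetIUr (fsetIidPr EA); move: leC; card_lia.
  - by move=> e; apply/eqP.
  by move=> e; case: CA; rewrite -e fsubsetIl.
have [g1 [g1emb g1f eg1 _]] := copyP hF F1F; have [g2 [g2emb g2f eg2 _]] := copyP hF CF.
have EN_im t : t \in base_image f `|` N -> exists i, t = g1 i.
  rewrite inE (base_imageE g1f) {1}eg1 => /orP[] /imfsetP[i _ ->]; by exists i.
(* [k] reads a point in the coordinates of the copy [N] and places it by those of [C]; the two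
   placements agree on the base. *)
have /choice[k hk] : forall t, exists u, forall i, t = g1 i -> u = g2 i.
  move=> t; have [[i ei]|h] := pselect (exists i, t = g1 i).
    by exists (g2 i) => j; rewrite ei => /g1emb.1 ->.
  by exists t => i ei; case: h; exists i.
have kg i : k (g1 i) = g2 i by apply: hk.
have kN : k @` N = C.
  apply/fsetP=> t; rewrite eg1 eg2; apply/imfsetP/imfsetP => -[u /=].
    by move=> /imfsetP[i /= hi ->] ->; exists i.
  by move=> hu ->; exists (g1 u); [apply/imfsetP; exists u | rewrite kg].
case: hn; exists (fun x => if x \in A then id x else k x).
have idA : id @` A = A by apply/fsetP=> t; rewrite in_fset.
split=> //; last first.
- suff -> : [fset (if x \in A then id x else k x) | x in N] = C by [].
  rewrite -kN; apply: eq_in_imfset => // x xN.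
  by case: ifP => // /(fdisjointP dAN); rewrite xN.
- by move=> x ->.
apply: (@pemb_glue M M A (base_image f) N id k) => //.
- by split.
- split=> [x y hx hy|x y z hx hy hz];
    have [i ->] := EN_im x hx; have [j ->] := EN_im y hy.
    by rewrite !kg => /g2emb.1 ->.
  have [l ->] := EN_im z hz; rewrite !kg.
  by apply: (iff_trans (iff_sym _)); [exact: g1emb.2 | exact: g2emb.2].
- move=> e; rewrite (base_imageE g1f) => /imfsetP[i /= hi ->].
  by rewrite kg -[i]/(val [` hi]) g1f g2f.
- by rewrite idA kN.
by rewrite idA kN.
Qed.

End Extension.

(** * One extension step on the natural numbers *)

Section SmallSets.
Variable M : structure.
Hypothesis pM : psts M.

Lemma predim_small (X : {fset M}) : (#|` X| <= 2)%N -> predim X = (#|` X|)%:Z.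
Proof.
move=> X2; rewrite /predim (_ : blocks X = fset0) ?cardfs0 ?subr0 //.
apply/fsetP=> T; rewrite in_fset0; apply/negP=> /blocksP[/fsubset_leq_card cT].
by move/(triple_card pM) => e; move: cT; rewrite e leqNgt ltnS X2.
Qed.

Lemma predim_triple (T : {fset M}) : triple T -> predim T = 2.
Proof.
move=> tT; have cT := triple_card pM tT.
rewrite /predim (_ : blocks T = [fset T]) ?cardfs1 ?cT //.
apply/fsetP=> T'; rewrite in_fset1; apply/blocksP/eqP => [[sT tT']|->] //.
by apply/eqP; rewrite eqEfcard sT cT (triple_card pM tT').
Qed.

Lemma triple_rel_iff (T : {fset M}) (x y z : M) : triple T -> x \in T -> y \in T -> z \in T ->
  rel3 x y z <-> [/\ x <> y, x <> z & y <> z].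
Proof.
move=> tT xT yT zT; split; first by case: pM => hd _ _ /hd.
by case=> *; apply: (triple_rel pM tT).
Qed.

End SmallSets.

Lemma predim_sub_blocks (M : structure) (X Y : {fset M}) : Y `<=` X ->
  (forall T, T `<=` X -> triple T -> T `<=` Y) -> predim Y <= predim X.
Proof.
move=> YX h; rewrite /predim; have -> : blocks Y = blocks X.
  apply/eqP; rewrite eqEfsubset blocks_sub //=; apply/fsubsetP=> T /blocksP[TX tT].
  by apply/blocksP; split=> //; exact: h.
by rewrite lerB // lez_nat; exact: fsubset_leq_card.
Qed.

(** All stages share the carrier [nat] and differ only in the relation, so the same finite set can
    be measured at several stages by [pdim]. *)
Definition natstr (r : nat -> nat -> nat -> Prop) : structure := Structure r.

Definition pdim (r : nat -> nat -> nat -> Prop) (X : {fset nat}) : int :=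
  predim (X : {fset natstr r}).

Definition below (n : nat) (X : {fset nat}) : {fset nat} := [fset x in X | (x < n)%N].

Definition supported (r : nat -> nat -> nat -> Prop) (n : nat) : Prop :=
  forall x y z, r x y z -> [/\ x < n, y < n & z < n]%N.

(** Naturals from [S.2] on lie in no triple and form a reserve of fresh points for later steps. *)
Definition good_state (s : nat -> bool) (S : (nat -> nat -> nat -> Prop) * nat) :=
  (forall A : {fset natstr S.1}, K_mu (mu_of s) A) /\ supported S.1 S.2.

(** The last clause makes the old points strong at the new stage, so that solutions found once
    remain strong in the limit. *)
Definition extends (S S' : (nat -> nat -> nat -> Prop) * nat) : Prop :=
  [/\ (S.2 < S'.2)%N,
      forall x y z, (x < S.2)%N -> (y < S.2)%N -> (z < S.2)%N ->
        S.1 x y z <-> S'.1 x y z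
    & forall X, pdim S'.1 (below S.2 X) <= pdim S'.1 X].

Lemma pdim_eq (r r' : nat -> nat -> nat -> Prop) (X : {fset nat}) :
  {in X & &, forall x y z, r x y z <-> r' x y z} -> pdim r X = pdim r' X.
Proof.
move=> h; have hp : @pemb (natstr r) (natstr r') X id by split.
rewrite /pdim -(predim_pemb hp); congr (@predim (natstr r') _).
by apply/fsetP=> t; rewrite in_fset.
Qed.

Lemma pdim_below r n X : supported r n -> pdim r (below n X) <= pdim r X.
Proof.
move=> hs; apply: (@predim_sub_blocks (natstr r)).
  by apply/fsubsetP=> t; rewrite !inE => /andP[].
move=> T TX [x [y [z [/hs[x1 y1 z1] e]]]].
apply/fsubsetP=> t tin; rewrite !inE (fsubsetP TX) //=.
by move: tin; rewrite e !inE -orbA => /or3P[] /eqP->.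
Qed.

Section Step.
Variables (s : nat -> bool) (r : nat -> nat -> nat -> Prop) (n : nat).
Hypothesis hgood : good_state s (r, n).
Variables (m : nat) (rB : 'I_m -> 'I_m -> 'I_m -> Prop).
Variables (A N : {fset finstr rB}) (f : finstr rB -> nat).
Hypotheses (hB : forall Y : {fset finstr rB}, K_mu (mu_of s) Y)
  (dAN : [disjoint A & N])
  (hle : predim A <= predim (A `|` N))
  (hlt : forall Y, Y `<=` N -> Y <> fset0 -> Y <> N -> predim A < predim (A `|` Y))
  (hf : @pemb (finstr rB) (natstr r) A f)
  (hfn : forall a, a \in A -> (f a < n)%N)
  (hfs : forall X : {fset nat}, f @` A `<=` X -> pdim r (f @` A) <= pdim r X).

Definition solved (S' : (nat -> nat -> nat -> Prop) * nat) : Prop :=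
  exists g : finstr rB -> nat,
    [/\ @pemb (finstr rB) (natstr S'.1) (A `|` N) g, {in A, g =1 f},
        forall b, b \in A `|` N -> (g b < S'.2)%N
      & forall X : {fset nat}, g @` (A `|` N) `<=` X ->
          pdim S'.1 (g @` (A `|` N)) <= pdim S'.1 X].

Let pB : psts (finstr rB) := psts_of_K_mu hB.
Let pr : psts (natstr r) := psts_of_K_mu hgood.1.

(** At relative predimension zero the image of A u N has the predimension of the strong set [f(A)],
    so it is strong as well. The relation stays the same; only the bound grows, past all values of
    [g], which may include isolated points above [n]. *)
Lemma solve_inside (g : finstr rB -> nat) :
  @pemb (finstr rB) (natstr r) (A `|` N) g -> {in A, g =1 f} ->
  predim (A `|` N) = predim A ->
  exists S', [/\ good_state s S', extends (r, n) S' & solved S'].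
Proof.
move=> hg gf e.
pose n' := (n + (\sum_(i : 'I_m) g i)%N).+1.
have nn' : (n < n')%N by rewrite ltnS leq_addr.
have hs := hgood.2; exists (r, n'); split.
- split; first exact: hgood.1.
  by move=> x y z /hs[? ? ?]; split; apply: ltn_trans nn'.
- by split=> // X; exact: pdim_below.
exists g; split=> //.
  move=> b _; rewrite ltnS /= (bigD1 b) //=; apply: leq_trans (leq_addl n _).
  exact: leq_addr.
move=> X gX; have -> : pdim r (g @` (A `|` N)) = pdim r (f @` A).
  by rewrite /pdim !predim_pemb.
apply: hfs; apply: fsubset_trans gX; apply/fsubsetP=> _ /imfsetP[a /= aA ->].
by rewrite -gf // in_imfset //= inE aA.
Qed.

(** The point [c] alone costs nothing over [A], so primitivity gives that [N] consists of [c]. The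
    third point [z] lies outside [f(A)], since [f] reflects the relation, and can be taken as the
    image of [c]. *)
Lemma solve_conflict x y c z : x \in A -> y \in A -> c \in N ->
  rB x y c -> r (f x) (f y) z ->
  exists S', [/\ good_state s S', extends (r, n) S' & solved S'].
Proof.
move=> xA yA cN rc rz.
have [hd hs hu] := pB; have [hd' hs' hu'] := pr; have [hi hr] := hf.
have [/eqP xy xc yc] := hd _ _ _ rc.
have cA : c \notin A by apply/negP=> /(fdisjointP dAN); rewrite cN.
have tT : @triple (finstr rB) [fset x; y; c] by exists x, y, c.
have eE : predim ([fset x; y] `|` [fset c] : {fset finstr rB}) = predim [fset x; y].
  by rewrite (predim_triple pB tT) predim_small // cardfs2 xy.
have sA : [fset x; y] `<=` A.
  by apply/fsubsetP=> t; rewrite !inE => /orP[] /eqP->.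
have dAc : [disjoint A & [fset c]] by rewrite fdisjointX1.
have eAc : predim (A `|` [fset c]) <= predim A.
  have := predim_submod A ([fset x; y] `|` [fset c]).
  have -> : A `|` ([fset x; y] `|` [fset c]) = A `|` [fset c].
    by rewrite fsetUA (fsetUidPl _ _ sA).
  have -> : A `&` ([fset x; y] `|` [fset c]) = [fset x; y].
    by rewrite fsetIUr (eqP dAc) fsetU0; apply/fsetIidPr.
  by rewrite eE; card_lia.
have eN : N = [fset c].
  apply: contrapT => ne; have := @hlt [fset c]; rewrite fsub1set cN.
  move=> /(_ isT) h; have : predim A < predim (A `|` [fset c]).
    by apply: h => [/fsetP /(_ c)|/esym //]; rewrite !inE eqxx.
  by rewrite ltNge eAc.
have eAN : predim (A `|` N) = predim A.
  by apply/eqP; rewrite eq_le hle eN eAc.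
have zA : z \notin f @` A.
  apply/negP=> /imfsetP[w /= wA ew]; have : rB x y w by apply/hr => //; rewrite -ew.
  by move=> /(hu _ _ _ _ rc) ecw; rewrite ecw wA in cA.
pose k t := if t == c then z else f t.
have kA t : t \in A -> k t = f t.
  by move=> tA; rewrite /k; case: eqP => // tc; rewrite -tc tA in cA.
have kc : k c = z by rewrite /k eqxx.
have tT' : @triple (natstr r) [fset f x; f y; z] by exists (f x), (f y), z.
have ki : {in [fset x; y] `|` [fset c] &, injective k}.
  have kA' t : t \in A -> k t <> k c.
    by move=> tA; rewrite kA // kc => e; move: zA; rewrite -e in_imfset.
  have inU t : t \in [fset x; y] `|` [fset c] -> t \in A \/ t = c.
    by rewrite inE => /orP[/(fsubsetP sA)|]; [left | rewrite inE => /eqP; right].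
  move=> a b /inU[aA|->] /inU[bA|->] //.
  - by rewrite !kA //; exact: hi.
  - by move/kA'; case.
  - by move/esym/kA'; case.
have kT t : t \in [fset x; y; c] -> k t \in [fset f x; f y; z].
  by rewrite !inE -orbA => /or3P[] /eqP->; rewrite ?(kA _ xA) ?(kA _ yA) ?kc eqxx ?orbT.
have hk : @pemb (finstr rB) (natstr r) ([fset x; y] `|` [fset c]) k.
  split=> // a b d ha hb hd0.
  apply: (iff_trans (triple_rel_iff pB tT ha hb hd0)).
  apply: (iff_trans _ (iff_sym (triple_rel_iff pr tT' (kT _ ha) (kT _ hb) (kT _ hd0)))).
  by split=> -[h1 h2 h3]; split=> e; [apply: h1|apply: h2|apply: h3|apply: h1|apply: h2|apply: h3];
    rewrite ?e //; exact: ki.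
have ec : k @` [fset c] = [fset z] by rewrite imfset_fset1 kc.
apply: (solve_inside (g := fun t => if t \in A then f t else k t)) => //; last first.
  by move=> t; rewrite /= => ->.
rewrite eN; apply: (pemb_glue (E := [fset x; y])) => //.
- by move=> t /(fsubsetP sA); exact: kA.
- by rewrite ec fdisjointX1.
- by rewrite -eN.
- by apply: hfs; exact: fsubsetUl.
Qed.

Let h (i : finstr rB) : nat := if i \in A then f i else (n + (i : 'I_m))%N.

Definition glued_rel (x y z : nat) : Prop := r x y z \/
  exists i j k : finstr rB, [/\ i \in A `|` N, j \in A `|` N, k \in A `|` N, rB i j k
    & [/\ x = h i, y = h j & z = h k]].

Lemma glued_emb_inj : {in A `|` N &, injective h}.
Proof.
have [hi _] := hf; move=> i j _ _; rewrite /h.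
case: ifP => iA; case: ifP => jA.
- exact: hi.
- by move=> e; have := hfn iA; rewrite e ltnNge leq_addr.
- by move=> e; have := hfn jA; rewrite -e ltnNge leq_addr.
by move/addnI => e; apply: val_inj.
Qed.

Lemma glued_emb_lt i : (h i < n)%N -> i \in A.
Proof. by rewrite /h; case: ifP => // _; rewrite ltnNge leq_addr. Qed.

Lemma glued_emb_base i : i \in A -> h i = f i.
Proof. by rewrite /h => ->. Qed.

Lemma glued_rel_old x y z : (x < n)%N -> (y < n)%N -> (z < n)%N ->
  r x y z <-> glued_rel x y z.
Proof.
move=> xn yn zn; split; first by left.
move=> [//|[i [j [k [_ _ _ rijk [ex ey ez]]]]]].
have [iA jA kA] : [/\ i \in A, j \in A & k \in A].
  by split; apply: glued_emb_lt; rewrite -?ex -?ey -?ez.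
rewrite ex ey ez !glued_emb_base //; exact/hf.2.
Qed.

Lemma glued_emb : @pemb (finstr rB) (natstr glued_rel) (A `|` N) h.
Proof.
split; first exact: glued_emb_inj.
move=> i j k iU jU kU; split; first by move=> rijk; right; exists i, j, k.
move=> [rh|[i' [j' [k' [i'U j'U k'U r' [ei ej ek]]]]]].
  have [hi hj hk] := hgood.2 _ _ _ rh.
  have [iA jA kA] : [/\ i \in A, j \in A & k \in A] by split; exact: glued_emb_lt.
  by apply/hf.2 => //; rewrite -!glued_emb_base.
rewrite (glued_emb_inj iU i'U ei) (glued_emb_inj jU j'U ej).
by rewrite (glued_emb_inj kU k'U ek).
Qed.

Hypothesis no_conflict : forall x y c z, x \in A -> y \in A -> c \in N ->
  rB x y c -> ~ r (f x) (f y) z.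

(** The delicate case is an old and a new triple sharing two points. Those come from [A]; the third
    point of the new triple is then in [A], where old uniqueness applies, or in [N], where
    [no_conflict] does. *)
Lemma glued_psts : psts (natstr glued_rel).
Proof.
have [hd hs hu] := pB; have [hd' hs' hu'] := pr.
have mixed i j k x y z w : i \in A `|` N -> j \in A `|` N -> k \in A `|` N ->
    rB i j k -> r x y z -> x = h i -> y = h j -> w = h k -> z = w.
  move=> iU jU kU rijk rxyz ex ey ew.
  have [xn yn zn] := hgood.2 _ _ _ rxyz.
  have [iA jA] : i \in A /\ j \in A by split; apply: glued_emb_lt; rewrite -?ex -?ey.
  move: kU; rewrite inE => /orP[kA|kN].
    apply: (hu' x y) => //; rewrite ex ey ew !glued_emb_base //; exact/hf.2.
  by case: (no_conflict (z := z) iA jA kN rijk); rewrite -!glued_emb_base // -ex -ey.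
split=> /=.
- move=> x y z [/hd'//|[i [j [k [iU jU kU /hd[n1 n2 n3] [-> -> ->]]]]]].
  by split=> /glued_emb_inj e; [apply: n1 | apply: n2 | apply: n3]; apply: e.
- move=> x y z [/hs'[r1 r2]|[i [j [k [iU jU kU /hs[r1 r2] [-> -> ->]]]]]].
    by split; left.
  by split; right; [exists j, i, k | exists i, k, j].
move=> x y z w [rz|[i [j [k [iU jU kU rk [ex ey ez]]]]]]
  [rw|[i' [j' [k' [i'U j'U k'U rk' [ex' ey' ew]]]]]].
- exact: hu' rz rw.
- exact: (mixed i' j' k' x y).
- by apply/esym; apply: (mixed i j k x y).
rewrite ez ew; congr h; apply: (hu i j) => //.
rewrite (glued_emb_inj iU i'U) -?ex -?ex' // (glued_emb_inj jU j'U) -?ey -?ey' //.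
Qed.

Lemma step_no_conflict : exists S', [/\ good_state s S', extends (r, n) S' & solved S'].
Proof.
have pG := glued_psts; have hs := hgood.2.
pose A' : {fset natstr glued_rel} := h @` A.
pose N' : {fset natstr glued_rel} := h @` N.
have AU a : a \in A -> a \in A `|` N by move=> aA; rewrite inE aA.
have NU a : a \in N -> a \in A `|` N by move=> aN; rewrite inE aN orbT.
have NA a : a \in N -> a \notin A.
  by move=> aN; apply/negP=> /(fdisjointP dAN); rewrite aN.
have N'n t : t \in N' -> (n <= t)%N.
  by move=> /imfsetP[a /= /NA /negPf aA ->]; rewrite /h aA leq_addr.
have A'n t : t \in A' -> (t < n)%N.
  by move=> /imfsetP[a /= aA ->]; rewrite glued_emb_base //; exact: hfn.
have eU : A' `|` N' = h @` (A `|` N) by rewrite imfsetU.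
have pd Y : Y `<=` A `|` N -> @predim (natstr glued_rel) (h @` Y) = predim Y.
  by move=> YU; apply: predim_pemb; apply: pemb_sub glued_emb.
have fA : f @` A = h @` A :> {fset nat}.
  by apply: eq_in_imfset => // a aA; rewrite glued_emb_base.
have off (X : {fset nat}) : [disjoint X & N'] ->
    {in X & &, forall x y z, r x y z <-> glued_rel x y z}.
  move=> /fdisjointP dX x y z xX yX zX; split; first by left.
  move=> [//|[i [j [k [iU jU kU rijk [ex ey ez]]]]]].
  have inA t a : t \in X -> a \in A `|` N -> t = h a -> a \in A.
    rewrite inE => tX /orP[//|aN] et; have := dX t tX.
    by rewrite et in_imfset.
  rewrite ex ey ez !glued_emb_base; [|exact: inA ez|exact: inA ey|exact: inA ex].
  by apply/hf.2 => //; [exact: inA ex|exact: inA ey|exact: inA ez].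
have dA'N' : [disjoint A' & N'].
  apply/fdisjointP=> t /A'n tn; apply/negP=> /N'n; by rewrite leqNgt tn.
have h1 (T : {fset natstr glued_rel}) : triple T -> T `<=` A' `|` N' \/ [disjoint T & N'].
  move=> [x [y [z [[/hs[xn yn zn]|[i [j [k [iU jU kU _ [ex ey ez]]]]]] ->]]]].
    right; apply/fdisjointP=> t tT; apply/negP=> /N'n; apply/negP; rewrite -ltnNge.
    by move: tT; rewrite !inE -orbA => /or3P[] /eqP->.
  left; rewrite eU; apply/fsubsetP=> t; rewrite !inE -orbA.
  by move=> /or3P[] /eqP->; rewrite ?ex ?ey ?ez in_imfset.
have h2 (X : {fset natstr glued_rel}) : [disjoint X & N'] -> K_mu (mu_of s) X.
  move=> dX; have hp : @pemb (natstr r) (natstr glued_rel) X id.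
    by split=> //; exact: off.
  have := K_mu_pemb pr pG hp (hgood.1 X).
  by rewrite (_ : id @` X = X) //; apply/fsetP=> t; rewrite in_fset.
have h3 : K_mu (mu_of s) (A' `|` N').
  by rewrite eU; apply: K_mu_pemb pB pG glued_emb (hB _).
have h4 : predim A' <= predim (A' `|` N').
  by rewrite eU !pd //; exact: fsubsetUl.
have h4' Y : Y `<=` N' -> Y <> fset0 -> Y <> N' -> predim A' < predim (A' `|` Y).
  move=> YN Y0 Y1; pose Z := [fset a in N | h a \in Y].
  have eY : Y = h @` Z.
    apply/fsetP=> t; apply/idP/imfsetP => [tY|[a /=]]; last first.
      by rewrite !inE /= => /andP[_ ?] ->.
    have /imfsetP[a /= aN ea] := fsubsetP YN t tY.
    by exists a => //; rewrite !inE /= aN -ea.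
  have ZN : Z `<=` N by apply/fsubsetP=> a; rewrite !inE => /andP[].
  rewrite eY -imfsetU !pd ?fsubsetUl //; last exact: fsetUS.
  apply: hlt => // e; first by apply: Y0; rewrite eY e imfset0.
  by apply: Y1; rewrite eY e.
have h5 (X : {fset natstr glued_rel}) : A' `<=` X -> [disjoint X & N'] ->
    predim A' <= predim X.
  move=> AX dX; have := hfs (X := X); rewrite fA => /(_ AX).
  rewrite (pdim_eq (off _ dX)) (pdim_eq (off _ dA'N')); exact.
case: (amalgam pG dA'N' h1 h2 h3 h4 h4' h5) => [hK|[h0 [hp0 id0 dN0 e0]]].
  have bnd i : (h i < (n + m).+1)%N.
    rewrite /h; case: ifP => iA; last by rewrite ltnS leq_add2l ltnW.
    by apply: leq_trans (hfn iA) _; rewrite leqW // leq_addr.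
  exists (glued_rel, (n + m).+1); split.
  - split=> // x y z [/hs[? ? ?]|[i [j [k [_ _ _ _ [-> -> ->]]]]]] /=; last by split; exact: bnd.
    by split; rewrite ltnS; apply: ltnW; apply: ltn_addr.
  - split=> /=; [by rewrite ltnS leq_addr | exact: glued_rel_old |].
    move=> X; apply: le_trans (amalgam_strong_old dA'N' h1 h4 h4' X).
    apply: (@predim_sub_blocks (natstr glued_rel)).
      apply/fsubsetP=> t; rewrite !inE => /andP[tX tn]; rewrite tX andbT.
      by apply/negP=> /N'n; rewrite leqNgt tn.
    move=> T TX tT; have [x [y [z [[/hs[xn yn zn]|[i [j [k [iU jU kU _ [ex ey ez]]]]]] e]]]] := tT.
      apply/fsubsetP=> t tin; have := fsubsetP TX t tin; rewrite !inE => /andP[_ ->].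
      by move: tin; rewrite e !inE -orbA => /or3P[] /eqP->.
    apply/fsubsetP=> t tin; have := fsubsetP TX t tin; rewrite !inE => /andP[tN' ->] /=.
    have /imfsetP[a /= aU ea] : t \in h @` (A `|` N).
      by move: tin; rewrite e !inE -orbA => /or3P[] /eqP->; rewrite ?ex ?ey ?ez in_imfset.
    have [aA|aA] := boolP (a \in A); first by rewrite ea glued_emb_base //; exact: hfn.
    case/negP: tN'; rewrite ea in_imfset //=.
    by move: aU; rewrite inE (negPf aA).
  exists h; split=> //; first exact: glued_emb.
    by move=> a aA; rewrite glued_emb_base.
  move=> X UX; have := amalgam_strong_new dA'N' h1 h4 h5 X.
  by rewrite eU (fsetIidPr UX).
(* The copy found in the glued structure avoids the new points, so by [off] it is already a copy for
   [r], and the gluing is discarded. *)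
have gN a : a \in A `|` N -> h0 (h a) \notin N'.
  rewrite inE => /orP[aA|aN].
    have haA : h a \in A' by apply: in_imfset.
    by rewrite (id0 _ haA); exact: (fdisjointP dA'N' _ haA).
  by apply: (fdisjointP dN0); do 2!apply: in_imfset.
apply: (solve_inside (g := fun i => h0 (h i))).
- have [hi hr] := hp0; split.
    move=> i j iU jU /hi e; apply: glued_emb_inj => //.
    by apply: e; rewrite eU in_imfset.
  move=> i j k iU jU kU; apply: (iff_trans (glued_emb.2 _ _ _ iU jU kU)).
  have hU a : a \in A `|` N -> h a \in A' `|` N' by move=> aU; rewrite eU in_imfset.
  apply: (iff_trans (hr _ _ _ (hU _ iU) (hU _ jU) (hU _ kU))).
  apply: iff_sym; apply: (off [fset h0 (h i); h0 (h j); h0 (h k)]);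
    rewrite ?inE ?eqxx ?orbT //.
  by apply/fdisjointP=> t; rewrite !inE -orbA => /or3P[] /eqP->; exact: gN.
- move=> a aA; have haA : h a \in A' by apply: in_imfset.
  by rewrite (id0 _ haA) /= glued_emb_base.
by move: e0; rewrite eU !pd //; exact: fsubsetUl.
Qed.

End Step.

Lemma step s r n (m : nat) (rB : 'I_m -> 'I_m -> 'I_m -> Prop)
    (A N : {fset finstr rB}) (f : finstr rB -> nat) :
  good_state s (r, n) -> (forall Y : {fset finstr rB}, K_mu (mu_of s) Y) ->
  [disjoint A & N] -> predim A <= predim (A `|` N) ->
  (forall Y, Y `<=` N -> Y <> fset0 -> Y <> N -> predim A < predim (A `|` Y)) ->
  @pemb (finstr rB) (natstr r) A f -> (forall a, a \in A -> (f a < n)%N) ->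
  (forall X : {fset nat}, f @` A `<=` X -> pdim r (f @` A) <= pdim r X) ->
  exists S', [/\ good_state s S', extends (r, n) S' & solved A N f S'].
Proof.
move=> hgood hB dAN hle hlt hf hfn hfs.
have [[x [y [c [z [xA yA cN [rc rz]]]]]]|hno] := pselect (exists x y c z,
  [/\ x \in A, y \in A, c \in N & rB x y c /\ r (f x) (f y) z]).
  exact: (solve_conflict hgood hB dAN hle hlt hf hfs xA yA cN rc rz).
apply: (step_no_conflict hgood hB dAN hle hlt hf hfn hfs).
by move=> x y c z xA yA cN rc rz; apply: hno; exists x, y, c, z.
Qed.

(** * The limit of the chain *)

Definition strong_image m (rB : 'I_m -> 'I_m -> 'I_m -> Prop) (r : nat -> nat -> nat -> Prop)
    (A : {fset finstr rB}) (f : finstr rB -> nat) : Prop :=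
  @pemb (finstr rB) (natstr r) A f /\
  forall X : {fset nat}, f @` A `<=` X -> pdim r (f @` A) <= pdim r X.

Definition primitive_ext s m (rB : 'I_m -> 'I_m -> 'I_m -> Prop)
    (A N : {fset finstr rB}) : Prop :=
  [/\ forall Y : {fset finstr rB}, K_mu (mu_of s) Y, [disjoint A & N],
      predim A <= predim (A `|` N)
    & forall Y, Y `<=` N -> Y <> fset0 -> Y <> N -> predim A < predim (A `|` Y)].

Lemma empty_good_state s : good_state s (fun _ _ _ => False, 0%N).
Proof.
have pE : psts (natstr (fun _ _ _ => False)) by split.
have e (X : {fset natstr (fun _ _ _ => False)}) : predim X = (#|` X|)%:Z.
  rewrite /predim (_ : blocks X = fset0) ?cardfs0 ?subr0 //.
  by apply/fsetP=> T; rewrite in_fset0; apply/negP=> /blocksP[_ [? [? [? []]]]].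
split=> // A; apply/(K_muP pE); split=> [X _|p f hf hA Fam hF]; first by rewrite e.
suff -> : Fam = fset0 by rewrite cardfs0.
apply/fsetP=> C; rewrite in_fset0; apply/negP=> /(good_copy pE hF)[dj C0 [e1 _] _].
apply: C0; apply: cardfs0_eq; move: e1; rewrite !e.
have := cardfsUI (base_image f) C; rewrite (eqP dj) cardfs0; card_lia.
Qed.

Section Chain.
Variable s : nat -> bool.

Definition state := {S : (nat -> nat -> nat -> Prop) * nat | good_state s S}.

(** Boolean tables and finite functions, in place of relations into [Prop], make the extension
    problems countable. *)
Definition task : countType := {m : nat & ({ffun 'I_m * 'I_m * 'I_m -> bool} *
  {fset 'I_m} * {fset 'I_m} * {ffun 'I_m -> nat})%type}.

Definition table_rel m (R : {ffun 'I_m * 'I_m * 'I_m -> bool}) (i j k : 'I_m) : Prop :=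
  R (i, j, k).

Definition handled (t : task) (S S' : state) : Prop :=
  let: existT m (R, A, N, f) := t in
  primitive_ext s (A : {fset finstr (table_rel R)}) N ->
  strong_image (sval S).1 (A : {fset finstr (table_rel R)}) f ->
  (forall a, a \in A -> (f a < (sval S).2)%N) ->
  solved (A : {fset finstr (table_rel R)}) N f (sval S').

Lemma handle (S : state) (t : task) :
  exists S' : state, extends (sval S) (sval S') /\ handled t S S'.
Proof.
case: t => m [[[R A] N] f]; rewrite /handled.
case: S => [[r n] hS] /=.
have [[h1 [h2 h3]]|hn] := pselect (primitive_ext s (A : {fset finstr (table_rel R)}) N /\
  strong_image r (A : {fset finstr (table_rel R)}) f /\
  (forall a, a \in A -> (f a < n)%N)).
  have [hB dAN hle hlt] := h1; have [hf hfs] := h2.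
  have [S' [h4 h5 h6]] := step hS hB dAN hle hlt hf h3 hfs.
  by exists (exist _ S' h4).
(* When the task is not a valid problem at this stage, the bound still grows, so that every natural
   is eventually below it. *)
have hS' : good_state s (r, n.+1).
  by split; [exact: hS.1 | move=> x y z /hS.2[? ? ?]; split; apply: ltnW].
exists (exist _ (r, n.+1) hS'); split; last by move=> h1 h2 h3; case: hn.
by split=> //= X; exact: pdim_below hS.2.
Qed.

(** The exponent of 2 in [i] takes each value at arbitrarily large [i], so each task recurs after
    its data have appeared. *)
Lemma chain_exists : exists S : nat -> state, forall i,
  extends (sval (S i)) (sval (S i.+1)) /\
  forall t : task, @choice.unpickle task (logn 2 i) = Some t -> handled t (S i) (S i.+1).
Proof.
have next (Si : state * nat) : exists S' : state, extends (sval Si.1) (sval S') /\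
    forall t : task, @choice.unpickle task (logn 2 Si.2) = Some t -> handled t Si.1 S'.
  case: Si => S i /=; case: (choice.unpickle _) => [t|].
    by have [S' [h1 h2]] := handle S t; exists S'; split=> // t' [<-].
  (* If the exponent codes no task, a task on zero points merely supplies some later stage. *)
  have [S' [h1 _]] := handle S (existT _ 0%N
    (finfun (fun=> false), fset0, fset0, finfun (fun=> 0%N))).
  by exists S'.
have [nx hnx] := choice next.
pose S0 : state := exist _ _ (empty_good_state s).
pose fix S i := if i is j.+1 then nx (S j, j) else S0.
by exists S => i; exact: (hnx (S i, i)).
Qed.

Section Limit.
Variable S : nat -> state.
Hypothesis hS : forall i, extends (sval (S i)) (sval (S i.+1)) /\
  forall t : task, @choice.unpickle task (logn 2 i) = Some t -> handled t (S i) (S i.+1).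

Let r i := (sval (S i)).1.
Let n i := (sval (S i)).2.

Definition limit_rel (x y z : nat) : Prop := exists i, r i x y z.

Let gS i : good_state s (r i, n i).
Proof. by have := proj2_sig (S i); rewrite /r /n; case: (sval (S i)). Qed.

Lemma chain_ge i : (i <= n i)%N.
Proof.
elim: i => // i IH; have [[h _ _] _] := hS i.
exact: leq_ltn_trans IH h.
Qed.

Lemma chain_mono i j : (i <= j)%N -> (n i <= n j)%N.
Proof.
elim: j => [|j IH]; first by rewrite leqn0 => /eqP->.
rewrite leq_eqVlt => /orP[/eqP->//|/IH h]; have [[h' _ _] _] := hS j.
exact: leq_trans h (ltnW h').
Qed.

Lemma chain_rel i j x y z : (i <= j)%N -> (x < n i)%N -> (y < n i)%N -> (z < n i)%N ->
  r i x y z <-> r j x y z.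
Proof.
move=> ij xn yn zn; elim: j ij => [|j IH]; first by rewrite leqn0 => /eqP->.
rewrite leq_eqVlt ltnS => /orP[/eqP->//|ij]; apply: (iff_trans (IH ij)).
have [[_ h _] _] := hS j.
by apply: h; apply: (leq_trans _ (chain_mono ij)).
Qed.

Lemma limit_relE i x y z : (x < n i)%N -> (y < n i)%N -> (z < n i)%N ->
  r i x y z <-> limit_rel x y z.
Proof.
move=> xn yn zn; split; first by exists i.
move=> [j rj]; have [xn' yn' zn'] := (gS j).2 _ _ _ rj.
by have [ij|/ltnW ij] := leqP i j; [apply/(chain_rel ij) | apply/(chain_rel ij)].
Qed.

Lemma chain_bound i (X : {fset nat}) : exists2 j, (i <= j)%N &
  forall x, x \in X -> (x < n j)%N.
Proof.
pose b := (\sum_(x <- X) x)%N.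
exists (i + b.+1)%N; first exact: leq_addr.
move=> x xX; apply: (leq_trans _ (chain_ge _)); apply: leq_trans (leq_addl _ _).
by rewrite ltnS /b (big_rem x) //= leq_addr.
Qed.

Lemma pdim_limit i X : (forall x, x \in X -> (x < n i)%N) ->
  pdim (r i) X = pdim limit_rel X.
Proof. by move=> h; apply: pdim_eq => x y z /h ? /h ? /h ?; exact: limit_relE. Qed.

Lemma limit_psts : psts (natstr limit_rel).
Proof.
have tr x y z w : exists2 i, psts (natstr (r i)) &
    [/\ x < n i, y < n i, z < n i & w < n i]%N.
  have [i _ h] := chain_bound 0 [fset x; y; z; w].
  exists i; first exact: psts_of_K_mu (gS i).1.
  by split; apply: h; rewrite !inE eqxx ?orbT.
split=> /=.
- move=> x y z hr; have [i [hd _ _] [xn yn zn _]] := tr x y z 0%N.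
  by apply: hd; apply/limit_relE.
- move=> x y z hr; have [i [_ hs _] [xn yn zn _]] := tr x y z 0%N.
  have /hs[r1 r2] : r i x y z by apply/limit_relE.
  by split; exists i.
move=> x y z w h1 h2; have [i [_ _ hu] [xn yn zn wn]] := tr x y z w.
by apply: (hu x y); apply/limit_relE.
Qed.

Lemma limit_K_mu (X : {fset natstr limit_rel}) : K_mu (mu_of s) X.
Proof.
have [i _ h] := chain_bound 0 X.
have hp : @pemb (natstr (r i)) (natstr limit_rel) X id.
  by split=> // x y z /h ? /h ? /h ?; exact: limit_relE.
have := K_mu_pemb (psts_of_K_mu (gS i).1) limit_psts hp ((gS i).1 X).
by rewrite (_ : id @` X = X) //; apply/fsetP=> t; rewrite in_fset.
Qed.

Lemma strong_limit i (Y : {fset nat}) : (forall y, y \in Y -> (y < n i)%N) ->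
  (forall X : {fset nat}, Y `<=` X -> pdim (r i) Y <= pdim (r i) X) ->
  forall X : {fset nat}, Y `<=` X -> pdim limit_rel Y <= pdim limit_rel X.
Proof.
move=> Yn hY X YX.
have main j : (i <= j)%N ->
    forall X : {fset nat}, Y `<=` X -> pdim (r j) Y <= pdim (r j) X.
  elim: j => [|j IH]; first by rewrite leqn0 => /eqP <-.
  rewrite leq_eqVlt ltnS => /orP[/eqP <-//|ij] X' YX'.
  have [[_ h1 h2] _] := hS j; apply: le_trans (h2 X').
  have Ynj y : y \in Y -> (y < n j)%N by move=> /Yn yn; apply: (leq_trans _ (chain_mono ij)).
  have eqj Z : (forall z, z \in Z -> (z < n j)%N) -> pdim (r j) Z = pdim (r j.+1) Z.
    by move=> hZ; apply: pdim_eq => x y z /hZ ? /hZ ? /hZ ?; exact: h1.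
  rewrite -[X in X <= _]/(pdim (r j.+1) Y) -(eqj Y Ynj) -[X in _ <= X]eqj; last first.
    by move=> z; rewrite !inE => /andP[].
  apply: IH => //; apply/fsubsetP=> y yY; rewrite !inE (fsubsetP YX') //=.
  exact: Ynj.
have [j ij hX] := chain_bound i X.
rewrite -(pdim_limit hX) -(@pdim_limit j Y); first exact: main.
by move=> y yY; apply: hX; exact: (fsubsetP YX).
Qed.

Lemma limit_primitive_ext m (rB : 'I_m -> 'I_m -> 'I_m -> Prop)
    (A N : {fset finstr rB}) (f : finstr rB -> nat) :
  primitive_ext s A N -> strong_image limit_rel A f ->
  exists g : finstr rB -> nat, strong_image limit_rel (A `|` N) g /\ {in A, g =1 f}.
Proof.
pose R : {ffun 'I_m * 'I_m * 'I_m -> bool} :=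
  [ffun t => `[< rB t.1.1 t.1.2 t.2 >]].
have eR : rB = table_rel R.
  apply/funext => i; apply/funext => j; apply/funext => k; apply/propext.
  by rewrite /table_rel ffunE /=; split; [move/asboolP | move/asboolP].
move: R eR => R eR; subst rB => hprim [hf hfs].
pose t : task := existT _ m (R, A, N, [ffun i => f i]).
have [b _ hb] := chain_bound 0 (f @` A).
(* The power of 2 makes stage [i] treat [t]; the power of 3 pushes [i] past [b], where [f(A)] is in
   range. *)
pose i := (2 ^ @choice.pickle task t * 3 ^ b)%N.
have ei : @choice.unpickle task (logn 2 i) = Some t.
  rewrite /i lognM ?expn_gt0 // lognX logn_prime //= muln1 lognX logn_prime //= muln0 addn0.
  exact: (@choice.pickleK task).
have bi : (b <= i)%N.
  apply: leq_trans (ltnW (ltn_expl b (isT : 1 < 3)%N)) _.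
  by rewrite /i leq_pmull // expn_gt0.
have fn a : a \in A -> (f a < n i)%N.
  by move=> aA; apply: (leq_trans _ (chain_mono bi)); apply: hb; rewrite in_imfset.
have [_ /(_ t ei)] := hS i; rewrite /handled /t /=.
have ef : fun_of_fin [ffun i : finstr (table_rel R) => f i] = f by apply/funext => a; rewrite ffunE.
rewrite ef => /(_ hprim) hh.
have fAn y : y \in f @` A -> (y < n i)%N by move=> /imfsetP[a /= aA ->]; exact: fn.
(* Strength descends from the limit to stage [i]: cutting a set down to points below the bound does
   not raise its predimension there, and on such points both relations agree. *)
have hsi : strong_image (r i) A f.
  split.
    split; first exact: hf.1.
    move=> x y z xA yA zA; apply: (iff_trans (hf.2 _ _ _ xA yA zA)).
    by apply: iff_sym; apply: limit_relE; exact: fn.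
  move=> X AX; apply: le_trans (pdim_below X (gS i).2).
  rewrite (pdim_limit fAn) pdim_limit; last by move=> x; rewrite !inE => /andP[].
  apply: hfs; apply/fsubsetP=> y yA; rewrite !inE (fsubsetP AX) //=.
  exact: fAn.
have [g [g1 g2 g3 g4]] := hh hsi fn.
exists g; split=> //; split.
  split; first exact: g1.1.
  move=> x y z xA yA zA; apply: (iff_trans (g1.2 _ _ _ xA yA zA)).
  by apply: limit_relE; exact: g3.
apply: (@strong_limit i.+1) => // y /imfsetP[a /= aA ->]; exact: g3.
Qed.

(** A smallest nonempty part [N] of [D] that costs nothing over [A], or else [N = D], is a primitive
    extension. In the first case A u N is again strong in A u D and the induction continues; in the
    second nothing remains. *)
Lemma limit_ext m (rB : 'I_m -> 'I_m -> 'I_m -> Prop)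
    (A D : {fset finstr rB}) (f : finstr rB -> nat) :
  (forall Y : {fset finstr rB}, K_mu (mu_of s) Y) -> [disjoint A & D] ->
  (forall Y, Y `<=` D -> predim A <= predim (A `|` Y)) -> strong_image limit_rel A f ->
  exists g : finstr rB -> nat, strong_image limit_rel (A `|` D) g /\ {in A, g =1 f}.
Proof.
move=> hB; have [k] := ubnP #|` D|.
elim: k => // k IH in A D f *; rewrite ltnS => Dk dAD hle hf.
have [->|/eqP D0] := eqVneq D fset0; first by exists f; rewrite fsetU0.
pose P Y := [/\ Y `<=` D, Y <> fset0 & predim (A `|` Y) = predim A \/ Y = D].
have exP : exists c, `[< exists2 Y, #|` Y| = c & P Y >].
  by exists #|` D|; apply/asboolP; exists D => //; split=> //; right.
case: (ex_minnP exP) => c /asboolP[N cN [ND N0 hN]] cmin.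
have dAN : [disjoint A & N] by exact: fdisjointWr dAD.
have hprim : primitive_ext s A N.
  split=> //; first exact: hle.
  move=> Y YN Y0 Y1; rewrite lt_neqAle hle ?andbT; last exact: fsubset_trans ND.
  apply/eqP => e; have := fproper_ltn_card (A := Y) (B := N).
  rewrite fproperEneq YN andbT; move/eqP: (Y1) => -> /(_ isT).
  rewrite cN ltnNge cmin //; apply/asboolP; exists Y => //; split=> //.
    exact: fsubset_trans ND.
  by left.
have [g [hg gf]] := limit_primitive_ext hprim hf.
have [||| |g' [hg' g'f]] := IH (A `|` N) (D `\` N) g.
- apply: leq_trans Dk; apply: fproper_ltn_card; rewrite fproperEneq fsubsetDl andbT.
  apply/eqP => e; apply: N0; apply/fsetP=> t; rewrite in_fset0; apply/negP=> tN.
  by have := fsubsetP ND t tN; rewrite -e inE tN.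
- rewrite fdisjointUX; apply/andP; split.
    by apply: fdisjointWr dAD; exact: fsubsetDl.
  by apply/fdisjointP=> t tN; rewrite inE tN.
- move=> Y YD; case: hN => [e|e]; last first.
    by move: YD; rewrite e fsetDv fsubset0 => /eqP->; rewrite fsetU0.
  rewrite e -fsetUA; apply: hle; rewrite fsubUset ND /=.
  by apply: fsubset_trans YD _; exact: fsubsetDl.
- exact: hg.
exists g'; split; last first.
  by move=> a aA; rewrite g'f ?gf // inE aA.
have -> : A `|` D = A `|` N `|` (D `\` N); last exact: hg'.
apply/fsetP=> t; have := fsubsetP ND t; rewrite !inE.
by case: (t \in A); case: (t \in N) => //=; rewrite ?orbT ?orbF // => /(_ isT) ->.
Qed.

Lemma limit_generic : generic (mu_of s) (natstr limit_rel).
Proof.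
have pL := limit_psts.
split; [exact: countableP | exact: limit_K_mu |].
move=> m rB A f B hKB [AB hAB] hf hsf.
have inB (x : finstr rB) : x \in B by rewrite in_fset.
have subB (Y : {fset finstr rB}) : Y `<=` B by apply/fsubsetP=> x _; exact: inB.
have hB (Y : {fset finstr rB}) : K_mu (mu_of s) Y by exact: K_mu_sub hKB.
have pB := psts_of_K_mu hB.
pose f' (x : finstr rB) : nat := if insub x is Some a then f (a : A) else 0%N.
have f'f (a : A) : f' (val a) = f a by rewrite /f' valK.
have ef : f' @` A = [fset f x | x : A].
  apply/fsetP=> t; apply/imfsetP/imfsetP => -[x /=].
    by move=> xA ->; exists [` xA] => //; rewrite -f'f.
  by move=> _ ->; exists (val x); rewrite ?f'f //; exact: valP.
have hf' : strong_image limit_rel A f'.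
  split.
    split=> [x y xA yA|x y z xA yA zA].
      rewrite (f'f [` xA]) (f'f [` yA]) => /hf.1 /(congr1 val); exact.
    by rewrite (f'f [` xA]) (f'f [` yA]) (f'f [` zA]) -(hf.2 _ _ _).
  move=> X; rewrite ef => /hsf; rewrite !deltaE //; exact.
have [||g [[g1 g2] gf]] := limit_ext (D := B `\` A) hB _ _ hf'.
- by apply/fdisjointP=> t tA; rewrite inE tA.
- move=> Y _; rewrite -!deltaE //; apply: hAB => //; exact: fsubsetUl.
have UB : A `|` (B `\` A) = B.
  by apply/fsetP=> t; rewrite in_fsetU in_fsetD inB; case: (t \in A).
rewrite UB in g1 g2.
exists g; split.
- by split=> [x y|x y z]; [apply: g1.1 | apply: g1.2].
- by move=> a; rewrite gf ?f'f //; exact: valP.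
have eg : [fset g x | x : 'I_m] = g @` B.
  apply/fsetP=> t; apply/imfsetP/imfsetP => -[x /= hx ->]; exists x => //; exact: inB.
by move=> X; rewrite eg !deltaE // => /g2; exact.
Qed.

End Limit.

Lemma generic_exists : exists M : structure, generic (mu_of s) M.
Proof. by have [S hS] := chain_exists; exists (natstr (limit_rel S)); exact: limit_generic. Qed.

End Chain.

(** * Cyclic configurations *)

Section Cyclic.
Variable k : nat.
Notation Z := 'I_(k + 6).+1.
Implicit Types (i j t x y z : Z) (a b c : nat).

Definition cyc (a : nat) : Z := inZp a.
Definition offsets : seq nat := [:: 0; 1; 3]%N.

(* [{0, 1, 3}] is a perfect difference set modulo 7, and its differences stay
   distinct modulo any larger number. *)
Definition cyclic_rel x y z : Prop :=
  exists i a b c, [/\ a \in offsets, b \in offsets, c \in offsets,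
    uniq [:: a; b; c] & [/\ x = i + cyc a, y = i + cyc b & z = i + cyc c]].

Lemma cyc_inj a b : (a < 7)%N -> (b < 7)%N -> cyc a = cyc b -> a = b.
Proof.
by move=> a7 b7 /(congr1 val); rewrite /= !modn_small //; lia.
Qed.

Lemma offsets_lt a : a \in offsets -> (a < 4)%N.
Proof. by rewrite !inE => /or3P[] /eqP->. Qed.

Lemma cycD a b : cyc a + cyc b = cyc (a + b).
Proof. by apply: val_inj; rewrite /= modnDm. Qed.

(** Sums of two offsets are at most 6, so congruence modulo k + 7 is equality of naturals; and the
    differences 1, 2, 3 of the offsets, with their signs, are distinct. *)
Lemma offsets_sidon i j a b a' b' : a \in offsets -> b \in offsets ->
  a' \in offsets -> b' \in offsets -> a != b ->
  i + cyc a = j + cyc a' -> i + cyc b = j + cyc b' -> [/\ a = a', b = b' & i = j].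
Proof.
move=> ha hb ha' hb' ab e1 e2.
have : cyc (a + b') = cyc (a' + b).
  rewrite -!cycD; apply: (@addrI _ (i + j)).
  by rewrite addrACA e1 -e2 (addrC i j) [RHS]addrACA.
have := (offsets_lt ha, offsets_lt hb, offsets_lt ha', offsets_lt hb').
move=> [[[la lb] la'] lb'] /cyc_inj e.
have {}e : (a + b' = a' + b)%N by apply: e; lia.
have [ea eb] : a = a' /\ b = b'.
  by move: ha hb ha' hb' ab e; rewrite !inE; lia.
by split=> //; move: e1; rewrite ea => /addIr.
Qed.

Lemma cyclic_psts : psts (finstr cyclic_rel).
Proof.
split.
- move=> x y z [i [a [b [c [ha hb hc u [-> -> ->]]]]]].
  have := (offsets_lt ha, offsets_lt hb, offsets_lt hc) => -[[la lb] lc].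
  move: u; rewrite /= !inE negb_or andbT => /andP[/andP[/eqP ab /eqP ac] /eqP bc].
  by split=> /addrI /cyc_inj e; [apply: ab | apply: ac | apply: bc]; apply: e; lia.
- move=> x y z [i [a [b [c [ha hb hc u [ex ey ez]]]]]].
  move: u; rewrite /= !inE negb_or andbT => /andP[/andP[ab ac] bc].
  split; [exists i, b, a, c | exists i, a, c, b]; split=> //;
    by rewrite /= !inE negb_or andbT ?[b == a]eq_sym ?[c == b]eq_sym ?ab ?ac ?bc.
move=> x y z w [i [a [b [c [ha hb hc u [ex ey ez]]]]]].
move=> [j [a' [b' [c' [ha' hb' hc' u' [ex' ey' ew]]]]]].
have ab : a != b by move: u; rewrite /= inE negb_or => /andP[/andP[]].
have [ea eb eij] := offsets_sidon ha hb ha' hb' ab (etrans (esym ex) ex') (etrans (esym ey) ey').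
rewrite ez ew eij; congr (_ + cyc _).
by move: ha hb hc hc' u u' ab; rewrite /= !inE -ea -eb; lia.
Qed.

Definition cyclic_block i : {fset finstr cyclic_rel} :=
  [fset i + cyc 0; i + cyc 1; i + cyc 3].

Lemma cyclic_blockP i t :
  reflect (exists2 a, a \in offsets & t = i + cyc a) (t \in cyclic_block i).
Proof.
apply: (iffP idP) => [|[a ha ->]].
  by rewrite !inE -orbA => /or3P[] /eqP->; [exists 0%N|exists 1%N|exists 3%N].
by move: ha; rewrite !inE => /or3P[] /eqP->; rewrite eqxx ?orbT.
Qed.

Lemma cyclic_triple (T : {fset finstr cyclic_rel}) :
  triple T <-> exists i, T = cyclic_block i.
Proof.
split=> [[x [y [z [[i [a [b [c [ha hb hc u [-> -> ->]]]]]] ->]]]]|[i ->]]; last first.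
  by exists (i + cyc 0), (i + cyc 1), (i + cyc 3); split=> //; exists i, 0%N, 1%N, 3%N.
exists i; apply/fsetP=> t; apply/idP/cyclic_blockP.
  by rewrite !inE -orbA => /or3P[] /eqP->; [exists a|exists b|exists c].
move=> [d hd ->]; rewrite !inE -orbA.
have : [|| d == a, d == b | d == c].
  by move: ha hb hc hd u; rewrite /= !inE; lia.
by move=> /or3P[] /eqP->; rewrite eqxx ?orbT.
Qed.

Lemma cyc0 i : i + cyc 0 = i.
Proof. by rewrite [cyc 0](_ : _ = 0) ?addr0 //; apply: val_inj; rewrite /= mod0n. Qed.

Lemma cyclic_block_inj : injective cyclic_block.
Proof.
move=> i j e.
have /cyclic_blockP[a ha e1] : i + cyc 0 \in cyclic_block j.
  by rewrite -e; apply/cyclic_blockP; exists 0%N.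
have /cyclic_blockP[b hb e2] : i + cyc 1 \in cyclic_block j.
  by rewrite -e; apply/cyclic_blockP; exists 1%N.
by have [] := @offsets_sidon i j 0 1 a b _ _ _ _ _ e1 e2.
Qed.

(** Each block is counted at its point [i] with offset 0, so no set contains more blocks than
    points. *)
Lemma cyclic_predim (X : {fset finstr cyclic_rel}) :
  predim X = (#|` X|)%:Z - (#|` [fset i in X | cyclic_block i `<=` X]|)%:Z.
Proof.
rewrite /predim; congr (_ - Posz _).
pose Y := [fset i in X | cyclic_block i `<=` X].
have -> : #|` [fset i in X | cyclic_block i `<=` X]| = #|` cyclic_block @` Y|.
  by rewrite [RHS]card_imfset; last exact: cyclic_block_inj.
congr #|` _|; apply/fsetP=> T; apply/blocksP/imfsetP => [[TX /cyclic_triple[i ei]]|[i /=]].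
  exists i => //; rewrite !inE /= -ei TX andbT; apply: (fsubsetP TX).
  by rewrite ei; apply/cyclic_blockP; exists 0%N; rewrite ?cyc0.
by rewrite !inE => /andP[_ ?] ->; split=> //; apply/cyclic_triple; exists i.
Qed.

Lemma cyclic_predim_ge0 (X : {fset finstr cyclic_rel}) : 0 <= predim X.
Proof.
rewrite cyclic_predim subr_ge0 lez_nat; apply: fsubset_leq_card.
by apply/fsubsetP=> t; rewrite !inE => /andP[].
Qed.

(** Equality means that the block of every [i] in [X] lies in [X]; so [X] is closed under adding 1,
    which generates the group. *)
Lemma cyclic_predim_eq0 (X : {fset finstr cyclic_rel}) : predim X = 0 ->
  X <> fset0 -> forall t, t \in X.
Proof.
rewrite cyclic_predim => /eqP; rewrite subr_eq0 => /eqP[e] /eqP/fset0Pn[i0 i0X] t.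
have eX : [fset i in X | cyclic_block i `<=` X] = X.
  apply/eqP; rewrite eqEfcard -e leqnn andbT.
  by apply/fsubsetP=> i; rewrite !inE => /andP[].
have hstep i : i \in X -> i + cyc 1 \in X.
  rewrite -{1}eX !inE => /andP[_ /fsubsetP]; apply.
  by apply/cyclic_blockP; exists 1%N.
have hm m : i0 + cyc m \in X.
  elim: m => [|m IH]; first by rewrite cyc0.
  by rewrite -[m.+1]addn1 -cycD addrA; exact: hstep.
have ev : cyc ((t : Z) - (i0 : Z))%R = (t : Z) - (i0 : Z) := valZpK _.
have -> : t = (i0 : Z) + cyc ((t : Z) - (i0 : Z))%R by rewrite ev addrC subrK.
exact: hm.
Qed.

Lemma cyclic_predim_full (X : {fset finstr cyclic_rel}) :
  (forall t, t \in X) -> predim X = 0.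
Proof.
move=> hX; rewrite cyclic_predim (_ : [fset i in X | _] = X) ?subrr //.
by apply/fsetP=> i; rewrite !inE hX; apply/fsubsetP=> t _; exact: hX.
Qed.

Lemma cyclic_good :
  is_good_pair (fset0 : {fset finstr cyclic_rel}) ([fset x | x : Z] `\` fset0).
Proof.
have full (t : Z) : t \in [fset x | x : Z] `\` fset0 by rewrite !inE.
split; last by move=> [B [/fproper_ltn_card]]; rewrite cardfs0.
have pC := cyclic_psts.
apply/(zero_primitiveP pC); split.
- exact: fdisjoint0X.
- by move=> /fsetP /(_ 0); rewrite full.
- by move=> X _; exact: cyclic_predim_ge0.
split; first by rewrite fset0U predim0 (cyclic_predim_full full).
move=> Y _ Y0 Y1; rewrite fset0U predim0 lt_neqAle cyclic_predim_ge0 andbT.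
apply/eqP=> /esym e; apply: Y1; apply/fsetP=> t; rewrite full.
exact: cyclic_predim_eq0 e Y0 t.
Qed.

Definition cyclic_pair : good_pair := GoodPair cyclic_good.

Lemma card_cyclic_ext : #|` gp_ext cyclic_pair| = (k + 7)%N.
Proof.
have -> : gp_ext cyclic_pair = [fset x | x : Z].
  by apply/fsetP=> t; rewrite !inE.
by rewrite card_imfset //= -cardE card_ord (addnS k 6).
Qed.

Lemma mu_bound_cyclic s : mu_bound s cyclic_pair = s k.
Proof. by rewrite /mu_bound card_cyclic_ext addnK eqxx; case: eqP => //; lia. Qed.

(** Over the empty base the only copy is the whole configuration. Over a base containing [e], each
    copy uses one of the three blocks through [e], so there are at most 9 of them. *)
Lemma cyclic_K_mu (s : nat -> bool) (X : {fset finstr cyclic_rel}) : s k -> K_mu (mu_of s) X.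
Proof.
move=> sk; have pC := cyclic_psts; apply/(K_muP pC); split.
  by move=> Y _; exact: cyclic_predim_ge0.
move=> p f hf hX Fam hF.
have [e1|e1] := eqVneq #|` gp_ext p| 1%N.
  by rewrite /mu_bound e1; exact: (single_copy pC hF).
have hg C (CF : C \in Fam) := good_copy pC hF CF.
rewrite /mu_bound (negPf e1) -cardfs_eq0 -(card_base_image hf) cardfs_eq0.
have [E0|/fset0Pn[e eE]] := eqVneq (base_image f) fset0.
  pose Z' : {fset finstr cyclic_rel} := [fset x | x : Z].
  have hC C : C \in Fam -> C = Z'.
    move=> CF; have [_ C0 [eC _] _] := hg C CF.
    rewrite E0 fset0U predim0 in eC; apply/fsetP=> t.
    by rewrite (cyclic_predim_eq0 eC C0) in_fset.
  have [->|/fset0Pn[C CF]] := eqVneq Fam fset0; first by rewrite cardfs0.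
  have -> : (#|` gp_ext p| - 7 = k)%N.
    rewrite -(card_copy hF CF) (hC C CF) card_imfset //= -cardE card_ord; lia.
  apply: leq_trans (fsubset_leq_card (B := [fset Z']) _) _; last by rewrite cardfs1 sk.
  apply/fsubsetP=> C' /hC ->.
  by rewrite in_fset1.
pose e' : Z := e.
pose W : {fset {fset finstr cyclic_rel}} :=
  [fset cyclic_block e'; cyclic_block (e' - cyc 1); cyclic_block (e' - cyc 3)].
apply: (@leq_trans (3 * #|` W|)%N); last first.
  have : (#|` W| <= 3)%N.
    rewrite /W fsetUC cardfsU1 cardfs2; by case: (_ \notin _); case: (_ != _).
  by lia.
apply: (card_family_meeting pC (copies_disjoint hF)).
  by move=> T; rewrite !inE -orbA => /or3P[] /eqP->; apply/cyclic_triple; eexists.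
move=> C CF; have [_ _ _ hb] := hg C CF; have [T hT [eT [y yC yT]]] := hb e eE.
exists T; last by exists y.
have [_ /cyclic_triple[i ei]] := blocksP _ _ hT.
have /cyclic_blockP[a ha ea] : e \in cyclic_block i by rewrite -ei.
have {}ea : i = e' - cyc a by rewrite /e' ea addrK.
rewrite ei ea !inE -orbA; move: ha; rewrite !inE => /or3P[] /eqP->; rewrite ?eqxx ?orbT //.
by have -> : e' - cyc 0 = e' by [rewrite -[LHS]cyc0 subrK]; rewrite eqxx.
Qed.

End Cyclic.

(** * Lines of the generic structure *)

(** Predimensions are nonnegative integers, so some finite superset has the least one, and that
    superset is strong. *)
Lemma strong_closure s (M : structure) (X : {fset M}) :
  (forall A : {fset M}, K_mu (mu_of s) A) -> exists2 A, X `<=` A & strong_in A.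
Proof.
move=> hK; have pM := psts_of_K_mu hK.
have h0 (A : {fset M}) : 0 <= predim A.
  exact: ((K_muP pM _ _).1 (hK A)).1.
have exP : exists c, `[< exists2 A : {fset M}, predim A = c%:Z & X `<=` A >].
  exists `|predim X|%N; apply/asboolP; exists X => //; by rewrite gez0_abs.
case: (ex_minnP exP) => c /asboolP[A cA XA] cmin.
exists A => // Y AY; rewrite !deltaE // cA.
have := cmin `|predim Y|%N; rewrite -lez_nat gez0_abs //; apply.
by apply/asboolP; exists Y; rewrite ?gez0_abs //; exact: fsubset_trans AY.
Qed.

(** Genericity speaks of structures on some ['I_n]; this transports it to finite subsets of any
    structure. A point of [B] serves as default for the numbering [e']. *)
Lemma generic_extension s (M N : structure) (A B : {fset N}) (f : N -> M) :
  generic (mu_of s) M -> psts N -> B <> fset0 -> K_mu (mu_of s) B -> strong A B ->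
  pemb A f -> strong_in (f @` A) ->
  exists g : N -> M, pemb B g /\ {in A, g =1 f}.
Proof.
move=> [_ hK hext] pN /eqP/fset0Pn[b0 b0B] hB [AB hAB] hf hfs.
have pM := psts_of_K_mu hK.
pose n := #|{: B}|.
pose e (i : 'I_n) : N := val (enum_val i : B).
pose rB (i j k : 'I_n) : Prop := rel3 (e i) (e j) (e k).
pose e' (x : N) : 'I_n := if insub x is Some b then enum_rank (b : B) else enum_rank [` b0B].
have e'K x : x \in B -> e (e' x) = x.
  by move=> xB; rewrite /e /e' insubT enum_rankK.
have eK i : e' (e i) = i.
  by rewrite /e' /e valK enum_valK.
have eB i : e i \in B by exact: valP.
have e_emb : @embedding (finstr rB) N e.
  by split=> [i j /(congr1 e')|//]; rewrite !eK.
have pB : psts (finstr rB) := psts_embedding e_emb pN.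
have e'_pemb X : X `<=` B -> @pemb N (finstr rB) X e'.
  move=> /fsubsetP XB; split=> [x y /XB xB /XB yB /(congr1 e)|x y z /XB xB /XB yB /XB zB].
    by rewrite !e'K.
  by rewrite /= /rB !e'K.
pose A0 : {fset finstr rB} := e' @` A.
pose f0 (a : substructure A0) : M := f (e (val a)).
have eA0 (a : substructure A0) : e (val a) \in A.
  have /imfsetP[x /= xA ->] := valP a.
  by rewrite e'K //; exact: (fsubsetP AB).
have eimg : [fset f0 x | x : substructure A0] = f @` A.
  apply/fsetP=> t; apply/imfsetP/imfsetP => -[x /= hx ->].
    by exists (e (val x)).
  have xA0 : e' x \in A0 by rewrite in_imfset.
  by exists [` xA0] => //; rewrite /f0 /= e'K //; exact: (fsubsetP AB).
have [||||g [[gi gr] gf _]] := hext n rB A0 f0.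
- suff -> : [fset x | x : 'I_n] = e' @` B.
    by apply: K_mu_pemb pN pB (e'_pemb B (fsubset_refl _)) hB.
  apply/fsetP=> t; rewrite in_fset; apply/esym/imfsetP; exists (e t); last by rewrite eK.
  exact: eB.
- split; first by apply/fsubsetP=> t _; rewrite in_fset.
  move=> X A0X _; rewrite !deltaE //.
  have -> : predim A0 = predim A by exact: (predim_pemb (e'_pemb A AB)).
  have <- : predim (e @` X) = predim X by exact: (predim_pemb (embedding_pemb X e_emb)).
  rewrite -!deltaE //; apply: hAB; last by apply/fsubsetP=> _ /imfsetP[i _ ->].
  apply/fsubsetP=> x xA; apply/imfsetP; exists (e' x) => /=.
    by apply: (fsubsetP A0X); rewrite in_imfset.
  by rewrite e'K //; exact: (fsubsetP AB).
- split=> [x y /hf.1 h|x y z].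
    by apply: val_inj; rewrite -[LHS]eK -[RHS]eK; congr e'; exact: h.
  apply: iff_trans (hf.2 _ _ _ (eA0 x) (eA0 y) (eA0 z)) => //.
- by rewrite eimg.
exists (g \o e'); split.
  split=> [x y xB yB /= /gi /(congr1 e)|x y z xB yB zB]; first by rewrite !e'K.
  by apply: iff_trans (gr _ _ _); rewrite /= /rB !e'K.
move=> x xA; have xA0 : e' x \in A0 by rewrite in_imfset.
by rewrite /= -[e' x]/(val [` xA0]) gf /f0 /= e'K //; exact: (fsubsetP AB).
Qed.

(** * Adjoining a third point to a pair that has none *)

Section AddPoint.
Variables (M : structure) (a b : M).
Hypotheses (pM : psts M) (ab : a <> b) (hab : forall c, ~ rel3 a b c).

Definition new_block : {fset option M} := [fset Some a; Some b; None].

Definition option_rel (x y z : option M) : Prop :=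
  (exists x0 y0 z0, [/\ x = Some x0, y = Some y0, z = Some z0 & rel3 x0 y0 z0]) \/
  [/\ x \in new_block, y \in new_block, z \in new_block & [/\ x <> y, x <> z & y <> z]].

Definition option_str : structure := Structure option_rel.

Lemma mem_new_block (x : option M) :
  x \in new_block -> [\/ x = Some a, x = Some b | x = None].
Proof. by rewrite !inE -orbA => /or3P[] /eqP; [apply: Or31 | apply: Or32 | apply: Or33]. Qed.

Lemma option_psts : psts option_str.
Proof.
have [hd hs hu] := pM.
have mixed x0 y0 z0 : rel3 x0 y0 z0 -> Some x0 \in new_block -> Some y0 \in new_block ->
    Some x0 <> Some y0 -> False.
  move=> r; have [r' _] := hs _ _ _ r.
  move=> h1 h2 ne.
  case: (mem_new_block h1) => [[e1]|[e1]|//]; case: (mem_new_block h2) => [[e2]|[e2]|//];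
    rewrite e1 e2 in r r' ne => //; by [apply: hab r | apply: hab r'].
split=> /=.
- move=> x y z [[x0 [y0 [z0 [-> -> -> /hd[h1 h2 h3]]]]]|[_ _ _]//].
  by split=> -[].
- move=> x y z [[x0 [y0 [z0 [-> -> -> /hs[r1 r2]]]]]|[hx hy hz [h1 h2 h3]]].
    by split; left; [exists y0, x0, z0 | exists x0, z0, y0].
  by split; right; split=> //; split=> //; exact: nesym.
move=> x y z w [[x0 [y0 [z0 [-> -> -> r]]]]|[hx hy hz [h1 h2 h3]]]
  [[x1 [y1 [w0 [ex ey ew r']]]]|[hx' hy' hw [h1' h2' h3']]].
- rewrite ew; congr Some; case: ex ey => ex [ey]; apply: (hu x0 y0) => //.
  by rewrite ex ey.
- by case: (mixed _ _ _ r).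
- by subst x y; case: (mixed _ _ _ r').
move: h1 h2 h3 h2' h3'.
by case: (mem_new_block hx) (mem_new_block hy) (mem_new_block hz) (mem_new_block hw)
  => -> [] -> [] -> [] ->.
Qed.

Lemma option_embedding : @embedding M option_str Some.
Proof.
split=> [x y []//|x y z]; split; first by left; exists x, y, z.
move=> [[x0 [y0 [z0 [[->] [->] [->]]]]]//|[hx hy hz [h1 h2 h3]]].
by move: h1 h2 h3; case: (mem_new_block hx) (mem_new_block hy) (mem_new_block hz)
  => // -> [] // -> [] // ->.
Qed.

Lemma option_new_blocks (X : {fset option_str}) :
  (#|` blocks ((None : option_str) |` X) `\` blocks X| <= 1)%N.
Proof.
have pO := option_psts.
apply: leq_trans (fsubset_leq_card (B := [fset new_block]) _) _; last by rewrite cardfs1.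
apply/fsubsetP=> T; rewrite in_fsetD => /andP[nT /(@blocksP option_str _ _)[sT tT]].
have [x [y [z [[[x0 [y0 [z0 [ex ey ez r0]]]]|[hx hy hz _]] eT]]]] := tT.
  case/negP: nT; apply/(@blocksP option_str); split=> //; apply/fsubsetP=> t tin.
  have := fsubsetP sT t tin; rewrite in_fsetU in_fset1 => /orP[/eqP tN|//].
  by move: tin; rewrite eT ex ey ez tN !inE.
rewrite in_fset1 eqEfcard (triple_card pO tT); apply/andP; split.
  by rewrite eT; apply/fsubsetP=> t; rewrite !inE -orbA => /or3P[] /eqP->;
    move: hx hy hz; rewrite !inE.
by rewrite /new_block fsetUC cardfsU1 cardfs2; case: (_ \notin _); case: (_ != _).
Qed.

End AddPoint.

(** If there were none, adjoin one to a strong finite set containing [a] and [b]: one point and one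
    block leave the predimension no smaller, and [K_mu_add_point] keeps the result in K_mu, so
    genericity realizes it in [M]. *)
Lemma third_point s (M : structure) (a b : M) : generic (mu_of s) M -> a <> b ->
  exists c, rel3 a b c.
Proof.
move=> hG ab; have [_ hK _] := hG; have pM := psts_of_K_mu hK.
apply: contrapT => h; have hab c : ~ rel3 a b c by move=> r; apply: h; exists c.
have pO := option_psts pM hab; have oemb := option_embedding a b.
pose O := option_str a b.
have [A abA strA] := strong_closure [fset a; b] hK.
have [aA bA] : a \in A /\ b \in A.
  by split; apply: (fsubsetP abA); rewrite !inE eqxx ?orbT.
pose A' : {fset O} := Some @` A.
pose B' : {fset O} := (None : O) |` A'.
have nA : (None : O) \notin A' by apply/negP=> /imfsetP[].
have KA' : K_mu (mu_of s) A'.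
  by apply: K_mu_pemb pM pO _ (hK A); exact: embedding_pemb.
have KB' : K_mu (mu_of s) B' by apply: K_mu_add_point => //; exact: option_new_blocks.
have strAB : strong A' B'.
  split; first exact: fsubsetUr.
  have leAB : predim A' <= predim B'.
    have := option_new_blocks pM hab A'; have := cardfsU1 (None : O) A'; rewrite nA /=.
    have := cardfsID (blocks A') (blocks B').
    have /fsetIidPr -> : blocks A' `<=` blocks B' by apply: blocks_sub; exact: fsubsetUr.
    by rewrite /predim -/B'; card_lia.
  move=> X A'X XB'; rewrite !deltaE //.
  have [nX|nX] := boolP ((None : O) \in X).
    suff -> : X = B' by [].
    apply/eqP; rewrite eqEfsubset XB' fsubUset A'X andbT.
    by apply/fsubsetP=> t; rewrite in_fset1 => /eqP->.
  suff -> : X = A' by [].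
  apply/eqP; rewrite eqEfsubset A'X andbT; apply/fsubsetP=> t tX.
  have := fsubsetP XB' t tX; rewrite in_fset1U => /orP[/eqP tN|//].
  by rewrite -tN tX in nX.
pose f (x : O) : M := if x is Some y then y else a.
have fA : f @` A' = A.
  apply/fsetP=> t; apply/imfsetP/idP => [[x /= /imfsetP[y /= yA ->] -> //]|tA].
  by exists (Some t) => //; rewrite in_imfset.
have fp : pemb A' f.
  split=> [x y /imfsetP[u /= _ ->] /imfsetP[v /= _ ->] /= ->//|].
  move=> x y z /imfsetP[u /= _ ->] /imfsetP[v /= _ ->] /imfsetP[w /= _ ->].
  exact: iff_sym (oemb.2 u v w).
have [||g [[gi gr] gf]] := generic_extension hG pO _ KB' strAB fp.
- by move=> /fsetP /(_ None); rewrite !inE.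
- by rewrite fA.
have sA x : x \in A -> (Some x : O) \in A' by move=> xA; rewrite in_imfset.
have sB x : x \in A -> (Some x : O) \in B' by move=> /sA h'; rewrite in_fset1U h' orbT.
have nB : (None : O) \in B' by rewrite in_fset1U eqxx.
apply: (hab (g None)).
have /(gr _ _ _ (sB _ aA) (sB _ bA) nB) : @rel3 O (Some a) (Some b) None.
  by right; split; rewrite ?inE ?eqxx ?orbT //; split=> // -[].
by rewrite (gf _ (sA _ aA)) (gf _ (sA _ bA)).
Qed.

Lemma generic_steiner s (M : structure) : generic (mu_of s) M -> steiner_system M.
Proof.
move=> hG; have [_ hK _] := hG; have pM := psts_of_K_mu hK.
split; first exact: psts_Kstar.
exists 3%N => l [[a [b [_ _ ab hab _]]]|[[_ cl] [x [y [z [[lx ly lz] [xy xz yz]]]]] _]].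
  by have [c r] := third_point hG ab; case: (hab c).
have r := cl x y z lx ly lz xy xz yz.
have -> : l = [set` [fset x; y; z]]%classic.
  apply/seteqP; split=> t /=; last first.
    by rewrite !inE -orbA => /or3P[] /eqP->.
  move=> lt; rewrite !inE.
  have [//|/eqP tx] := eqVneq t x; have [//|/eqP ty] := eqVneq t y.
  have [_ _ hu] := pM; apply/eqP; apply: (hu x y) => //.
  by apply: cl => // e; [apply: tx | apply: ty].
apply/card_eq_fsetP; apply: (triple_card pM); by exists x, y, z.
Qed.

(** * First-order theories *)

Section Diagrams.

Definition ftrue n : formula n := FAll (FEq (ord0 : 'I_n.+1) ord0).

Definition fands n (T : Type) (F : T -> formula n) (l : seq T) : formula n :=
  foldr (fun x phi => FAnd (F x) phi) (ftrue n) l.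

Lemma sat_fands (M : structure) n (T : eqType) (F : T -> formula n) (l : seq T)
    (v : n.-tuple M) :
  sat (fands F l) v <-> forall x, x \in l -> sat (F x) v.
Proof.
elim: l => [|y l IH] /=; first by split=> // _ x.
split=> [[h1 /IH h2] x|h].
  by rewrite inE => /orP[/eqP->|/h2].
split; first by apply: h; rewrite inE eqxx.
by apply/IH => x xl; apply: h; rewrite inE xl orbT.
Qed.

Fixpoint fall n : formula n -> formula 0 :=
  if n is m.+1 then fun phi => fall (FAll phi) else id.

Lemma sat_fall (M : structure) n (phi : formula n) :
  sat (fall phi) ([tuple] : 0.-tuple M) <-> forall v : n.-tuple M, sat phi v.
Proof.
elim: n phi => [|n IH] phi /=.
  by split=> [h v|]; [rewrite [v]tuple0 | exact].
apply: (iff_trans (IH _)); split=> [h v|h v x]; last exact: h.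
by rewrite (tuple_eta v); exact: h.
Qed.

Definition diagram n (r : 'I_n -> 'I_n -> 'I_n -> Prop) : formula n :=
  FAnd (fands (fun t => if t.1 == t.2 then ftrue n else FNot (FEq t.1 t.2))
         (enum {: 'I_n * 'I_n}))
       (fands (fun t => if `[< r t.1.1 t.1.2 t.2 >] then FRel t.1.1 t.1.2 t.2
                        else FNot (FRel t.1.1 t.1.2 t.2))
         (enum {: 'I_n * 'I_n * 'I_n})).

Lemma sat_diagram (M : structure) n (r : 'I_n -> 'I_n -> 'I_n -> Prop) (v : n.-tuple M) :
  sat (diagram r) v <-> @embedding (finstr r) M (tnth v).
Proof.
split.
  move=> [/sat_fands h1 /sat_fands h2]; split=> [i j e|i j k].
    have := h1 (i, j); rewrite mem_enum => /(_ isT) /=.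
    by case: eqP => [->//|_] /=; case.
  have := h2 (i, j, k); rewrite mem_enum => /(_ isT) /=.
  by case: asboolP => hr /= h; split.
move=> [hi hr]; split; apply/sat_fands => -[i j] _ /=.
  by case: eqP => [//|ne] /= /hi.
by case: i => i1 i2 /=; case: asboolP => h /=; [apply/hr | move/hr].
Qed.

Definition no_copy_sentence n (r : 'I_n -> 'I_n -> 'I_n -> Prop) : formula 0 :=
  fall (FNot (diagram r)).

Lemma sat_no_copy (M : structure) n (r : 'I_n -> 'I_n -> 'I_n -> Prop) :
  Th M (no_copy_sentence r) <-> forall g : finstr r -> M, ~ embedding g.
Proof.
apply: (iff_trans (sat_fall _ _)); split=> /= h.
  move=> g [gi gr]; apply: (h [tuple g i | i < n]).
  by apply/sat_diagram; split=> [i j|i j k]; rewrite !tnth_mktuple; [exact: gi|exact: gr].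
by move=> v /sat_diagram /h.
Qed.

End Diagrams.

Section Theories.
Variables (s : nat -> bool) (M : structure).
Hypothesis hG : generic (mu_of s) M.

Lemma generic_has_cyclic k : s k ->
  exists g : finstr (@cyclic_rel k) -> M, embedding g.
Proof.
move=> sk; have [_ hK hext] := hG; have pM := psts_of_K_mu hK.
have pC := cyclic_psts k.
have /choice[a0 _] : forall a : substructure (fset0 : {fset finstr (@cyclic_rel k)}),
    exists x : M, True.
  by move=> a; have := valP a; rewrite in_fset0.
have [||||g [gemb _ _]] := hext _ (@cyclic_rel k) fset0 a0.
- exact: cyclic_K_mu.
- split; first exact: fsub0set.
  by move=> X _ _; rewrite !deltaE // predim0; exact: cyclic_predim_ge0.
- by split=> [a|a]; have := valP a; rewrite in_fset0.
- move=> X _; rewrite !deltaE //.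
  suff -> : [fset a0 x | x : _] = fset0.
    by rewrite predim0; exact: ((K_muP pM _ _).1 (hK X)).1.
  by apply/fsetP=> t; rewrite in_fset0; apply/negP=> /imfsetP[a]; have := valP a; rewrite in_fset0.
by exists g.
Qed.

(** The image is a family of one copy of [cyclic_pair] over the empty base, where the bound is [s k]
    read as a number. *)
Lemma generic_no_cyclic k (g : finstr (@cyclic_rel k) -> M) : embedding g -> s k.
Proof.
move=> gemb; have [_ hK _] := hG; have pM := psts_of_K_mu hK.
pose p := cyclic_pair k.
pose C := g @` gp_ext p.
pose f (b : substructure (gp_base p)) : M := g (val b).
have hf : embedding f.
  by have [gi gr] := gemb; split=> [a b /gi /val_inj//|a b c]; exact: gr.
have [_ hc] := (K_muP pM _ _).1 (hK C).
have hD : disjoint_copies C f [fset C].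
  split; last by move=> C1 C2; rewrite !in_fset1 => /eqP-> /eqP->.
  by move=> C'; rewrite in_fset1 => /eqP->; split=> //; exists g.
have := hc p f hf _ _ hD; rewrite cardfs1 mu_bound_cyclic.
case: (s k) => // h; suff : (1 <= false)%N by []; apply: h => b.
by have := valP b; rewrite in_fset0.
Qed.

End Theories.

Lemma mu_of_inj : injective mu_of.
Proof.
move=> s t e; apply/funext => k; have := congr1 (fun m => m (cyclic_pair k)) e.
by rewrite /mu_of !mu_bound_cyclic; case: (s k) (t k) => -[].
Qed.

Theorem corollary5p23 :
  exists V : set (good_pair -> int),
    [/\ (V `<=` calU)%classic,
        (V #= [set: nat -> bool]%classic)%card,
        forall mu, V mu -> exists M : structure, generic mu M,
        forall mu (M : structure), V mu -> generic mu M -> steiner_system M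
      & forall mu nu, V mu -> V nu -> mu <> nu ->
        forall M N : structure, generic mu M -> generic nu N -> Th M <> Th N].
Proof.
exists [set mu_of s | s in [set: nat -> bool]]%classic; split.
- by move=> _ [s _ <-]; exact: mu_of_calU.
- by apply: inj_card_eq => s t _ _; exact: mu_of_inj.
- by move=> _ [s _ <-]; exact: generic_exists.
- by move=> _ M [s _ <-]; exact: generic_steiner.
have main (s t : nat -> bool) (M N : structure) k : s k -> ~~ t k -> generic (mu_of s) M ->
    generic (mu_of t) N -> Th M <> Th N.
  move=> sk tk hM hN eT.
  have : Th N (no_copy_sentence (@cyclic_rel k)).
    by apply/sat_no_copy => g /(generic_no_cyclic hN); rewrite (negPf tk).
  rewrite -eT => /sat_no_copy h.
  by have [g /h] := generic_has_cyclic hM sk.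
move=> _ _ [s _ <-] [t _ <-] ne M N hM hN.
have [k nk] : exists k, s k <> t k.
  apply: contrapT => h; apply: ne; congr mu_of; apply/funext => k.
  by apply: contrapT => nk; apply: h; exists k.
case sk: (s k); case tk: (t k); first by rewrite sk tk in nk.
- by apply: (main s t M N k) => //; rewrite tk.
- by move/esym; apply: (main t s N M k) => //; rewrite sk.
by rewrite sk tk in nk.
Qed.
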